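(* There is an absolute constant $C>0$ such that the following holds. Suppose $P$ is weakly communicating, let $s_0\in\mathcal S$ be arbitrary, $\eta=1/n$ and $\xi=\frac{1}{2n^2}$, and let $\widehat\pi$ be a Blackwell-optimal policy of $(\underline{\widehat P},\widetilde r)$. Then for every $\delta\in(0,1)$, with probability at least $1-\delta$, $$\rho^\star-\rho^{\widehat\pi}\le\sqrt{\frac{C\log^3\!\big(\frac{SAn}{\delta}\big)}{n}\Big(\|h^\star\|_{\mathrm{sp}}+\min\{\|\underline{\widehat h}^{\widehat\pi}\|_{\mathrm{sp}},\|\underline h^{\widehat\pi}\|_{\mathrm{sp}}\}+1\Big)}\;\mathbf 1 .$$
   Context: $\mathcal S$ finite with $S$ states, $\mathcal A$ finite with $A$ actions; transition kernel $P$; known reward $r:\mathcal S\times\mathcal A\to[0,1]$. Empirical kernel $\widehat P$: $n$ i.i.d. samples from each $P(\cdot|s,a)$, independent across pairs, $\widehat P(s'|s,a)$ = fraction equal to $s'$. Anchored kernels $\underline{\widehat P}(s'|s,a)=(1-\eta)\widehat P(s'|s,a)+\eta\mathbb 1\{s'=s_0\}$, $\underline P(s'|s,a)=(1-\eta)P(s'|s,a)+\eta\mathbb 1\{s'=s_0\}$. Perturbed reward $\widetilde r=r+\Delta$, $\Delta(s,a)$ i.i.d. Uniform$[0,\xi]$ independent of the samples. Gain $\rho^\pi=P^\infty_\pi r_\pi$, bias $h^\pi=\mathrm{C\text{-}lim}_T\sum_{t<T}(P_\pi^tr_\pi-\rho^\pi)$. Blackwell-optimal for $(Q,\tilde r)$: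 deterministic policy maximizing $(I-\gamma Q_\pi)^{-1}\tilde r_\pi$ for all $\gamma$ in some $[\bar\gamma,1)$. $\rho^\star,h^\star$: gain and bias of a Blackwell-optimal policy of $(P,r)$. $\underline{\widehat h}^{\pi}$ and $\underline h^\pi$: biases of $\pi$ in $(\underline{\widehat P},r)$ and $(\underline P,r)$ respectively (unperturbed reward). $\|x\|_{\mathrm{sp}}=\max x-\min x$. Weakly communicating: states split into states transient under every stationary policy and a set where every state is reachable from every other. *)

(* Defs.v *)
From HB Require Import structures.
From mathcomp Require Import all_boot all_order all_algebra.
From mathcomp Require Import all_classical all_reals all_analysis.
Set Implicit Arguments. Unset Strict Implicit. Unset Printing Implicit Defensive.
Import Order.TTheory GRing.Theory Num.Theory.
Import numFieldNormedType.Exports.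
Local Open Scope ring_scope.

Section MDP.
Variables (R : realType) (S A : finType).

Definition app (M : S -> S -> R) (v : S -> R) : S -> R :=
  fun x => \sum_(y : S) M x y * v y.

Definition mpow (M : S -> S -> R) (t : nat) (v : S -> R) : S -> R :=
  iter t (app M) v.

Definition is_kernel (Q : S -> A -> S -> R) : Prop :=
  forall s a, (forall s', 0 <= Q s a s') /\ \sum_(s' : S) Q s a s' = 1.

Definition Ppi (Q : S -> A -> S -> R) (pi : S -> A) : S -> S -> R :=
  fun x y => Q x (pi x) y.
Definition rpi (r : S -> A -> R) (pi : S -> A) : S -> R :=
  fun x => r x (pi x).

Definition cesaro_lim (u : nat -> R) : R :=
  limn (fun N : nat => N%:R^-1 * \sum_(k < N) u k).

(* gain rho^pi = P_pi^infty r_pi, with P_pi^infty the Cesaro limit of P_pi^t *)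
Definition gain (Q : S -> A -> S -> R) (r : S -> A -> R) (pi : S -> A) : S -> R :=
  fun s => cesaro_lim (fun t => mpow (Ppi Q pi) t (rpi r pi) s).

Definition bias (Q : S -> A -> S -> R) (r : S -> A -> R) (pi : S -> A) : S -> R :=
  fun s => cesaro_lim (fun T => \sum_(t < T) (mpow (Ppi Q pi) t (rpi r pi) s - gain Q r pi s)).

(* discounted value (I - g Q_pi)^{-1} r_pi = sum_t g^t Q_pi^t r_pi *)
Definition disc_value (g : R) (Q : S -> A -> S -> R) (r : S -> A -> R) (pi : S -> A) : S -> R :=
  fun s => limn (fun N : nat => \sum_(t < N) g ^+ t * mpow (Ppi Q pi) t (rpi r pi) s).

Definition blackwell_optimal (Q : S -> A -> S -> R) (r : S -> A -> R) (pi : S -> A) : Prop :=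
  exists gbar : R, 0 <= gbar < 1 /\
    forall g : R, gbar <= g < 1 ->
      forall (pi' : S -> A) (s : S), disc_value g Q r pi' s <= disc_value g Q r pi s.

(* span seminorm: max_{s,s'} (v s - v s') = max v - min v (S nonempty) *)
Definition spn (v : S -> R) : R :=
  \big[Num.max/0]_(s : S) \big[Num.max/0]_(s' : S) (v s - v s').

Definition is_stat_policy (mu : S -> A -> R) : Prop :=
  forall s, (forall a, 0 <= mu s a) /\ \sum_(a : A) mu s a = 1.
Definition Pmu (Q : S -> A -> S -> R) (mu : S -> A -> R) : S -> S -> R :=
  fun x y => \sum_(a : A) mu x a * Q x a y.

Definition taboo (M : S -> S -> R) (s : S) : S -> S -> R :=
  fun x y => if y == s then 0 else M x y.
(* probability that the chain started at s ever returns to s: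
   sum_{t>=0} P(first return at time t+1) *)
Definition return_prob (M : S -> S -> R) (s : S) : R :=
  limn (fun N : nat => \sum_(t < N) mpow (taboo M s) t (fun y => M y s) s).
Definition transient (M : S -> S -> R) (s : S) : Prop := return_prob M s < 1.
Definition reachable (M : S -> S -> R) (s s' : S) : Prop :=
  exists t : nat, 0 < mpow M t (fun y => if y == s' then 1 else 0) s.

Definition weakly_communicating (Q : S -> A -> S -> R) : Prop :=
  exists C : {set S},
    (forall s, s \notin C -> forall mu, is_stat_policy mu -> transient (Pmu Q mu) s) /\
    (forall s s', s \in C -> s' \in C -> exists pi : S -> A, reachable (Ppi Q pi) s s').

Definition emp_kernel (n : nat) (X : S -> A -> 'I_n -> S) : S -> A -> S -> R :=
  fun s a s' => (\sum_(k < n) (X s a k == s')%:R) / n%:R.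

Definition anchor (eta : R) (s0 : S) (Q : S -> A -> S -> R) : S -> A -> S -> R :=
  fun s a s' => (1 - eta) * Q s a s' + eta * (s' == s0)%:R.

End MDP.

Local Open Scope classical_set_scope.
Definition unif_cdf {R : realType} (xi x : R) : R := Num.min 1 (Num.max 0 (x / xi)).

(* Joint law of the data: X s a k (k < n) i.i.d. ~ P(.|s,a), independent across
   pairs, and Delta s a i.i.d. Uniform[0,xi] independent of the samples.
   Specified through the joint distribution on the pi-system
   {X = w, Delta <= b} (which generates sigma(X, Delta)). *)
Definition data_law {R : realType} {S A : finType} {d : measure_display}
  {T : measurableType d} (Pr : probability T R) (P : S -> A -> S -> R) (n : nat) (xi : R)
  (X : T -> S -> A -> 'I_n -> S) (Delta : T -> S -> A -> R) : Prop :=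
  forall (w : S -> A -> 'I_n -> S) (b : S -> A -> R),
    let E := [set t | (forall s a k, X t s a k = w s a k) /\
                      (forall s a, Delta t s a <= b s a)] in
    measurable E /\
    Pr E = ((\prod_(s : S) \prod_(a : A) \prod_(k < n) P s a (w s a k)) *
            (\prod_(s : S) \prod_(a : A) unif_cdf xi (b s a)))%:E.

(* Main.v *)
Require Import Defs.
From HB Require Import structures.
From mathcomp Require Import all_boot all_order all_algebra.
From mathcomp Require Import all_classical all_reals all_analysis.
From mathcomp Require Import ring lra.
Import Order.TTheory GRing.Theory Num.Theory.
Import numFieldNormedType.Exports.
Set Implicit Arguments.
Unset Strict Implicit.
Unset Printing Implicit Defensive.
Local Open Scope ring_scope.
Local Open Scope classical_set_scope.

(** Put [g = 1 - 1/n].  Anchoring at [s0] with weight [1/n] is [g]-discounting in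
    disguise: biases of an anchored model agree with [g]-discounted values up to
    a constant, and [pihat] is [g]-discounted optimal for the perturbed empirical
    model.  As the optimal gain is constant, [V^pistar] is within the span of
    [h^star] of [n rho^star], while [rho^pihat >= min V^pihat / n]; so it is enough
    to bound [V^pistar - V^pihat], which telescopes through the empirical values
    of [pistar] and [pihat], the middle difference being controlled by optimality.

    The two model errors follow from Bernstein's inequality in the linear form
    [|(Phat - P) f| <= 2 lam Var f + L / (n lam)], with [lam] of order
    [sqrt (L / (n span f))], and a potential argument that absorbs the accumulated
    variance.  For [pihat] one may take [f] to be either its empirical or its true
    value, whence the minimum of the two spans.

    Both choices depend on the samples at the pair [p] under consideration.  Let
    [p] terminate with a payoff [q] instead: the resulting optimal value and greedy
    policy do not see the samples at [p], and [q] may be restricted to a finite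
    grid.  The optimal values are approximated by those on the grid; the
    policy [pihat] itself is attained, because the reward perturbation
    separates the actions.  Cutting the range of the perturbation into [K] cells
    reduces all probabilities to finite sums. *)

(** * Finite Markov chains and discounted values *)

(** The obstacle is that Bernstein's inequality needs a vector fixed independently of the samples,
    and a scale [lam] tuned to the span of that vector, whereas the value of [pihat] and its span
    are both random. A union over all policies would cost a factor S in the exponent. Leaving one
    pair out leaves a family with the single real parameter [q], so a polynomial grid costs only a
    logarithm.

    Closeness suffices for empirical values, which vary continuously with [q]; the true value of
    [pihat] does not, so there the policy itself has to be recovered. With everything else fixed,
    only of order n^2 of the K cells of one pair can produce a near tie. Taking K of order x^2,
    where x = SAn/delta, makes near ties cost at most delta/2.

    The linear form is preferred to a square root of the variance because its variance term is
    cancelled directly by the drift of the squared value. This requires [lam] times the span to be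
    small; where that may fail, n is below a multiple of the bracket and the claimed bound exceeds
    1. *)

Section Matrices.
Variables (R : realType) (S : finType).
Implicit Types (M : S -> S -> R) (f u v : S -> R).

Definition substochastic M :=
  forall x, (forall y, 0 <= M x y) /\ \sum_y M x y <= 1.
Definition stochastic M :=
  forall x, (forall y, 0 <= M x y) /\ \sum_y M x y = 1.

Lemma stochasticW M : stochastic M -> substochastic M.
Proof. by move=> h x; have [h1 h2] := h x; split => //; rewrite h2. Qed.

Lemma eq_app M u v s : u =1 v -> app M u s = app M v s.
Proof. by move=> h; apply: eq_bigr => y _; rewrite h. Qed.

Lemma appD M u v s : app M (fun x => u x + v x) s = app M u s + app M v s.
Proof. by rewrite /app -big_split; apply: eq_bigr => y _; rewrite mulrDr. Qed.

Lemma appN M u s : app M (fun x => - u x) s = - app M u s.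
Proof. by rewrite /app -sumrN; apply: eq_bigr => y _; rewrite mulrN. Qed.

Lemma appB M u v s : app M (fun x => u x - v x) s = app M u s - app M v s.
Proof. by rewrite appD appN. Qed.

Lemma appZ M k u s : app M (fun x => k * u x) s = k * app M u s.
Proof. by rewrite /app mulr_sumr; apply: eq_bigr => y _; rewrite mulrCA. Qed.

Lemma app_cst M k s : stochastic M -> app M (fun=> k) s = k.
Proof. by move=> h; rewrite /app -mulr_suml (h s).2 mul1r. Qed.

Lemma app_sum M (n : nat) (F : nat -> S -> R) s :
  app M (fun x => \sum_(i < n) F i x) s = \sum_(i < n) app M (F i) s.
Proof. by rewrite exchange_big /=; apply: eq_bigr => y _; rewrite mulr_sumr. Qed.

Lemma le_app M u v s : substochastic M -> (forall y, u y <= v y) ->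
  app M u s <= app M v s.
Proof. by move=> h uv; apply: ler_sum => y _; rewrite ler_wpM2l ?(h s).1. Qed.

Lemma app_le M u (b : R) s : substochastic M -> 0 <= b -> (forall y, u y <= b) ->
  app M u s <= b.
Proof.
move=> h b0 ub; apply: (@le_trans _ _ (app M (fun=> b) s)); first exact: le_app.
by rewrite /app -mulr_suml ler_piMl ?(h s).2.
Qed.

Lemma app_le_stoch M u (b : R) s : stochastic M -> (forall y, u y <= b) ->
  app M u s <= b.
Proof.
move=> h ub; rewrite -[leRHS](app_cst b s h).
by apply: le_app => //; exact: stochasticW.
Qed.

Lemma app_ge_stoch M u (b : R) s : stochastic M -> (forall y, b <= u y) ->
  b <= app M u s.
Proof.
move=> h ub; rewrite -[leLHS](app_cst b s h).
by apply: le_app => //; exact: stochasticW.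
Qed.

Lemma ler_norm_app M u s : substochastic M ->
  `|app M u s| <= app M (fun x => `|u x|) s.
Proof.
move=> h; apply: le_trans (ler_norm_sum _ _ _) _; apply: ler_sum => y _.
by rewrite normrM (ger0_norm ((h s).1 y)).
Qed.

Lemma fun_ub f : exists2 b : R, 0 <= b & forall s, `|f s| <= b.
Proof.
exists (\sum_s `|f s|) => [|s]; first by apply: sumr_ge0 => *.
by rewrite (bigD1 s) //= lerDl sumr_ge0.
Qed.

(** Evaluate at a maximiser of [f]. Rows may have mass below one, as they will for a terminating
    pair, so [app M f m <= f m] is safe only for a nonnegative maximum; hence the case split. *)
Lemma max_principle M g f b : substochastic M -> 0 <= g < 1 -> 0 <= b ->
  (forall s, f s <= g * app M f s + b) -> forall s, f s <= b / (1 - g).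
Proof.
move=> hM /andP[g0 g1] b0 hf s.
have [m _ hm] := @Order.TotalTheory.arg_maxP _ _ _ s xpredT f isT.
apply: (le_trans (hm s isT)); rewrite ler_pdivlMr ?subr_gt0 //.
have [fm|fm] := leP (f m) 0.
  by apply: le_trans b0; rewrite mulr_le0_ge0 // subr_ge0 ltW.
have := hf m; have : app M f m <= f m by apply: app_le (ltW fm) _ => // y; exact: hm.
move=> /(ler_wpM2l g0); lra.
Qed.

Lemma max_principle0 M g f : substochastic M -> 0 <= g < 1 ->
  (forall s, f s <= g * app M f s) -> forall s, f s <= 0.
Proof.
move=> hM hg hf s; have := @max_principle M g f 0 hM hg (lexx _).
by rewrite mul0r; apply => x; rewrite addr0.
Qed.

Lemma max_principle_norm M g f b : substochastic M -> 0 <= g < 1 -> 0 <= b ->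
  (forall s, `|f s - g * app M f s| <= b) -> forall s, `|f s| <= b / (1 - g).
Proof.
move=> hM hg b0 hf; apply: (@max_principle M g (fun s => `|f s|)) => // s.
have := ler_norm_app f s hM; have /andP[g0 g1] := hg.
move=> /(ler_wpM2l g0) h1.
have -> : f s = (f s - g * app M f s) + g * app M f s by rewrite subrK.
apply: le_trans (ler_normD _ _) _; rewrite addrC lerD ?hf //.
by rewrite normrM (ger0_norm g0).
Qed.

Lemma max_principle_eq M g f : substochastic M -> 0 <= g < 1 ->
  (forall s, f s = g * app M f s) -> forall s, f s = 0.
Proof.
move=> hM hg hf s; apply/eqP; rewrite -normr_eq0 eq_le normr_ge0 andbT.
have := @max_principle_norm M g f 0 hM hg (lexx _).
by rewrite mul0r; apply => x; rewrite -hf subrr normr0.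
Qed.

Lemma mpowS M t f s : mpow M t.+1 f s = app M (mpow M t f) s.
Proof. by []. Qed.

Lemma eq_mpow M t u v : u =1 v -> mpow M t u =1 mpow M t v.
Proof. by move=> h; elim: t => //= t IH s; exact: eq_app. Qed.

Lemma mpowSr M t f s : mpow M t.+1 f s = mpow M t (app M f) s.
Proof. by rewrite /mpow iterSr. Qed.

Lemma mpow_norm M t f b : substochastic M -> 0 <= b -> (forall s, `|f s| <= b) ->
  forall s, `|mpow M t f s| <= b.
Proof.
move=> hM b0 hf; elim: t => //= t IH s.
apply: le_trans (ler_norm_app _ _ hM) _; exact: app_le.
Qed.

Lemma mpow_le M t u v : substochastic M -> (forall s, u s <= v s) ->
  forall s, mpow M t u s <= mpow M t v s.
Proof. by move=> hM uv; elim: t => //= t IH s; exact: le_app. Qed.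

Lemma mpowB M t u v s :
  mpow M t (fun x => u x - v x) s = mpow M t u s - mpow M t v s.
Proof. by elim: t s => //= t IH s; rewrite (eq_app _ _ IH) appB. Qed.

Lemma mpowD M t u v s :
  mpow M t (fun x => u x + v x) s = mpow M t u s + mpow M t v s.
Proof. by elim: t s => //= t IH s; rewrite (eq_app _ _ IH) appD. Qed.

Lemma cvg_sum_fin (I : Type) (r : seq I) (F : I -> nat -> R) (l : I -> R) :
  (forall i, F i @ \oo --> l i) ->
  (fun N => \sum_(i <- r) F i N) @ \oo --> \sum_(i <- r) l i.
Proof.
move=> h; elim: r => [|i r IH].
  rewrite big_nil; have -> : (fun N => \sum_(i <- [::]) F i N) = fun=> 0.
    by apply/funext => N; rewrite big_nil.
  exact: cvg_cst.
rewrite big_cons; have -> : (fun N => \sum_(j <- i :: r) F j N) =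
    (fun N => F i N + \sum_(j <- r) F j N).
  by apply/funext => N; rewrite big_cons.
exact: cvgD.
Qed.

Lemma cvg_mx_app M (F : nat -> S -> R) (l : S -> R) s :
  (forall y, (fun N => F N y) @ \oo --> l y) ->
  (fun N => app M (F N) s) @ \oo --> app M l s.
Proof.
by move=> h; apply: cvg_sum_fin => y; apply: cvgM => //; exact: cvg_cst.
Qed.

Lemma cvg_mean0 (u : nat -> R) (b : R) : (forall N, `|u N| <= b) ->
  (fun N : nat => N%:R^-1 * u N) @ \oo --> (0 : R).
Proof.
move=> hu; have b0 : 0 <= b by apply: le_trans (hu 0%N).
have h : (fun N : nat => (2 * b) * harmonic N) @ \oo --> (0 : R).
  by rewrite -[X in _ --> X](mulr0 (2 * b)); apply: cvgM cvg_harmonic; exact: cvg_cst.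
apply/norm_cvg0P; apply: (squeeze_cvgr _ (cvg_cst 0) h).
near=> N.
have N0 : (0 < N)%N by near: N; exists 1%N.
rewrite normr_ge0 /= normrM normfV normr_nat /harmonic /=.
(* [harmonic N] is [1 / (N + 1)], which costs the factor 2. *)
have h2 : (N%:R^-1 : R) <= 2 * N.+1%:R^-1.
  rewrite -[leLHS]div1r ler_pdivrMr ?ltr0n // mulrAC ler_pdivlMr ?ltr0Sn //.
  by rewrite mul1r -natrM ler_nat mul2n -addnn -addn1 leq_add2l.
by rewrite mulrAC; apply: ler_pM.
Unshelve. all: end_near. Qed.

Lemma disc_series_cvg M g f s : substochastic M -> 0 <= g < 1 ->
  cvgn (fun N : nat => \sum_(t < N) g ^+ t * mpow M t f s).
Proof.
move=> hM /andP[g0 g1]; have [b b0 hb] := fun_ub f.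
have -> : (fun N : nat => \sum_(t < N) g ^+ t * mpow M t f s) =
    series (fun t => g ^+ t * mpow M t f s).
  by apply/funext => N; rewrite /series /= big_mkord.
apply: (@normed_cvg _ R^o).
apply: (@series_le_cvg _ _ (geometric b g)) => [t|t|t|].
- exact: normr_ge0.
- by rewrite /geometric /= mulr_ge0 // exprn_ge0.
- rewrite /geometric /= normrM normrX (ger0_norm g0) mulrC ler_wpM2r ?exprn_ge0 //.
  exact: mpow_norm.
- by apply: is_cvg_geometric_series; rewrite ger0_norm.
Qed.
End Matrices.

(** * Discounted evaluation, policy improvement and optimal values *)

Section Discounted.
Variables (R : realType) (S A : finType).
Implicit Types (Q : S -> A -> S -> R) (r : S -> A -> R) (pi : S -> A) (V : S -> R).

Definition subkernel Q := forall s a, (forall s', 0 <= Q s a s') /\ \sum_s' Q s a s' <= 1.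

Lemma is_kernelW Q : is_kernel Q -> subkernel Q.
Proof. by move=> h s a; have [h1 h2] := h s a; split => //; rewrite h2. Qed.

Lemma subkernel_Ppi Q pi : subkernel Q -> substochastic (Ppi Q pi).
Proof. by move=> h s; exact: h. Qed.

Lemma kernel_Ppi Q pi : is_kernel Q -> stochastic (Ppi Q pi).
Proof. by move=> h s; exact: h. Qed.

Lemma disc_valueE g Q r pi s : subkernel Q -> 0 <= g < 1 ->
  disc_value g Q r pi s =
  rpi r pi s + g * app (Ppi Q pi) (disc_value g Q r pi) s.
Proof.
move=> hQ hg; have hM := subkernel_Ppi pi hQ.
set M := Ppi Q pi in hM *; set f := rpi r pi.
pose F N y := \sum_(t < N) g ^+ t * mpow M t f y.
have cF y : F ^~ y @ \oo --> disc_value g Q r pi y by exact: disc_series_cvg.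
have c1 : (fun N => F N.+1 s) @ \oo --> disc_value g Q r pi s.
  by have := cF s; rewrite -(cvg_shiftS (F ^~ s)).
have c2 : (fun N => F N.+1 s) @ \oo --> f s + g * app M (disc_value g Q r pi) s.
  have -> : (fun N => F N.+1 s) = (fun N => f s + g * app M (F N) s).
    apply/funext => N; rewrite /F big_ord_recl expr0 mul1r; congr (_ + _).
    rewrite (app_sum M N (fun t y => g ^+ t * mpow M t f y)) mulr_sumr.
    apply: eq_bigr => t _.
    by rewrite appZ mulrA -exprS.
  apply: cvgD; first exact: cvg_cst.
  by apply: cvgM; [exact: cvg_cst | exact: cvg_mx_app].
exact: (cvg_unique _ c1 c2).
Qed.

Lemma disc_value_unique g Q r pi V : subkernel Q -> 0 <= g < 1 ->
  (forall s, V s = rpi r pi s + g * app (Ppi Q pi) V s) ->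
  forall s, V s = disc_value g Q r pi s.
Proof.
move=> hQ hg hV s; apply/eqP; rewrite -subr_eq0; apply/eqP.
apply: (@max_principle_eq _ _ (Ppi Q pi) g
  (fun s => V s - disc_value g Q r pi s)) => //; first exact: subkernel_Ppi.
by move=> x; rewrite appB {1}hV {1}disc_valueE //; ring.
Qed.

Lemma disc_value_lip g Q r r' pi e : subkernel Q -> 0 <= g < 1 ->
  (forall s a, `|r s a - r' s a| <= e) ->
  forall s, `|disc_value g Q r pi s - disc_value g Q r' pi s| <= e / (1 - g).
Proof.
move=> hQ hg he s.
have e0 : 0 <= e by exact: le_trans (he s (pi s)).
apply: (@max_principle_norm _ _ (Ppi Q pi) g
  (fun s => disc_value g Q r pi s - disc_value g Q r' pi s)) => //.
  exact: subkernel_Ppi.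
move=> x; rewrite appB disc_valueE // [disc_value g Q r' pi x]disc_valueE //.
apply: le_trans (he x (pi x)); rewrite le_eqVlt; apply/orP; left; apply/eqP.
by rewrite /rpi; congr (`|_|); ring.
Qed.

Lemma disc_value_le g Q r r' pi : subkernel Q -> 0 <= g < 1 ->
  (forall s a, r s a <= r' s a) ->
  forall s, disc_value g Q r pi s <= disc_value g Q r' pi s.
Proof.
move=> hQ hg he s; rewrite -subr_le0.
apply: (@max_principle0 _ _ (Ppi Q pi) g
  (fun s => disc_value g Q r pi s - disc_value g Q r' pi s)) => //.
  exact: subkernel_Ppi.
move=> x; rewrite appB disc_valueE // [disc_value g Q r' pi x]disc_valueE //.
by have := he x (pi x); rewrite /rpi; lra.
Qed.

Lemma disc_value_bounds g Q r pi b : subkernel Q -> 0 <= g < 1 -> 0 <= b ->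
  (forall s a, 0 <= r s a <= b) ->
  forall s, 0 <= disc_value g Q r pi s <= b / (1 - g).
Proof.
move=> hQ hg b0 hr s; apply/andP; split.
  rewrite -oppr_le0.
  apply: (@max_principle0 _ _ (Ppi Q pi) g (fun s => - disc_value g Q r pi s)) => //.
    exact: subkernel_Ppi.
  move=> x; rewrite appN {1}disc_valueE //.
  by have /andP[] := hr x (pi x); rewrite /rpi; lra.
apply: (@max_principle _ _ (Ppi Q pi) g) => //; first exact: subkernel_Ppi.
move=> x; rewrite {1}disc_valueE //.
by have /andP[] := hr x (pi x); rewrite /rpi; lra.
Qed.

(** Policy improvement at a single state: [V] is a subsolution of the evaluation equation of the
    switched policy, so it lies below the new value, and one Bellman step at [s] makes the gain
    strict. *)
Lemma policy_switch g Q r pi s a : subkernel Q -> 0 <= g < 1 ->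
  disc_value g Q r pi s < r s a + g * \sum_y Q s a y * disc_value g Q r pi y ->
  exists pi', (forall y, disc_value g Q r pi y <= disc_value g Q r pi' y) /\
    disc_value g Q r pi s < disc_value g Q r pi' s.
Proof.
move=> hQ hg hlt; pose pi' x := if x == s then a else pi x.
set V := disc_value g Q r pi in hlt *; set V' := disc_value g Q r pi'.
have hM := subkernel_Ppi pi' hQ.
have eV x : V x <= rpi r pi' x + g * app (Ppi Q pi') V x.
  rewrite /rpi /app /Ppi /pi'; case: eqP => [->|_]; first exact: ltW.
  by rewrite {1}/V disc_valueE.
have h x : V x - V' x <= 0.
  apply: (@max_principle0 _ _ (Ppi Q pi') g (fun s => V s - V' s)) => // y.
  by rewrite appB {1}/V' disc_valueE // -/V'; have := eV y; lra.
exists pi'; split => [y|]; first by rewrite -subr_le0 h.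
apply: (lt_le_trans hlt); rewrite (disc_valueE r pi') // -/V' /rpi.
rewrite {1}/pi' eqxx lerD2l ler_wpM2l //; first by case/andP: hg.
have -> : \sum_y Q s a y * V y = app (Ppi Q pi') V s by rewrite /app /Ppi /pi' eqxx.
by apply: le_app => // y; rewrite -subr_le0.
Qed.

(** Blackwell optimality only compares policies. A violated Bellman inequality at some [g] would
    yield, by a switch at one state, a better policy for that same [g]. *)
Lemma blackwell_bellman Q r pi : subkernel Q -> blackwell_optimal Q r pi ->
  exists2 gb : R, 0 <= gb < 1 & forall g, gb <= g < 1 -> forall s a,
    r s a + g * \sum_y Q s a y * disc_value g Q r pi y <= disc_value g Q r pi s.
Proof.
move=> hQ [gb [/andP[gb0 gb1] hb]]; exists gb; first by rewrite gb0.
move=> g hg s a; rewrite leNgt; apply/negP => hlt.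
have hg' : 0 <= g < 1 by case/andP: hg => h1 ->; rewrite andbT; exact: le_trans h1.
have [pi' [_]] := policy_switch hQ hg' hlt.
by rewrite ltNge hb.
Qed.

(** The Bellman optimality equation, split into an upper bound and its attainment so that no maximum
    over [A] has to be formed. *)
Definition is_opt g Q r V := forall s,
  (forall a, r s a + g * \sum_y Q s a y * V y <= V s) /\
  exists a, V s = r s a + g * \sum_y Q s a y * V y.

(** Values of different policies need not be comparable state by state, so their sums over [S] are
    maximised; a maximiser admits no improvement by [policy_switch]. *)
Lemma is_opt_exists g Q r (a0 : A) : subkernel Q -> 0 <= g < 1 ->
  exists V, is_opt g Q r V.
Proof.
move=> hQ hg.
pose F (p : {ffun S -> A}) := \sum_s disc_value g Q r p s.
have [p _ hp] := @Order.TotalTheory.arg_maxP _ _ _ [ffun=> a0] xpredT F isT.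
exists (disc_value g Q r p) => s; split => [a|].
  rewrite leNgt; apply/negP => hlt.
  have [pi' [h1 h2]] := policy_switch hQ hg hlt.
  have : F (finfun pi') <= F p by exact: hp.
  rewrite leNgt => /negP; apply; rewrite /F.
  have -> : \sum_s disc_value g Q r (finfun pi') s = \sum_s disc_value g Q r pi' s.
    by apply: eq_bigr => x _; congr (disc_value g Q r _ x); apply/funext => y; rewrite ffunE.
  rewrite (bigD1 s) //= [ltRHS](bigD1 s) //=; apply: ltr_leD => //.
  exact: ler_sum.
by exists (p s); rewrite disc_valueE.
Qed.

Lemma is_opt_disc_value g Q r V pi : subkernel Q -> 0 <= g < 1 -> is_opt g Q r V ->
  (forall s, V s = r s (pi s) + g * \sum_y Q s (pi s) y * V y) ->
  V =1 disc_value g Q r pi.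
Proof. by move=> hQ hg hV e; apply: disc_value_unique. Qed.

Lemma is_opt_ge g Q r V pi : subkernel Q -> 0 <= g < 1 -> is_opt g Q r V ->
  forall s, disc_value g Q r pi s <= V s.
Proof.
move=> hQ hg hV s; rewrite -subr_le0.
apply: (@max_principle0 _ _ (Ppi Q pi) g (fun s => disc_value g Q r pi s - V s)) => //.
  exact: subkernel_Ppi.
move=> x; rewrite appB {1}disc_valueE // /rpi.
by have := (hV x).1 (pi x); rewrite -/(app (Ppi Q pi) V x); lra.
Qed.

Lemma is_opt_lip g Q r r' V V' e : subkernel Q -> 0 <= g < 1 -> 0 <= e ->
  is_opt g Q r V -> is_opt g Q r' V' -> (forall s a, `|r s a - r' s a| <= e) ->
  forall s, `|V s - V' s| <= e / (1 - g).
Proof.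
move=> hQ hg e0.
suff main r1 r2 V1 V2 : is_opt g Q r1 V1 -> is_opt g Q r2 V2 ->
  (forall s a, `|r1 s a - r2 s a| <= e) -> forall s, V1 s - V2 s <= e / (1 - g).
  move=> h1 h2 he s; rewrite ler_norml lerNl opprB (main r' r V' V) //=.
    by apply: main h1 h2 he s.
  by move=> x a; rewrite distrC.
move=> h1 h2 he s.
have /choice[pi hpi] : forall s, exists a, V1 s = r1 s a + g * \sum_y Q s a y * V1 y.
  by move=> x; have [] := h1 x.
apply: (@max_principle _ _ (Ppi Q pi) g (fun s => V1 s - V2 s)) => //.
  exact: subkernel_Ppi.
move=> x; rewrite appB {1}hpi -/(app (Ppi Q pi) V1 x).
have := (h2 x).1 (pi x); rewrite -/(app (Ppi Q pi) V2 x).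
have := he x (pi x); rewrite ler_norml => /andP[]; lra.
Qed.

Lemma is_opt_bounds g Q r V b : subkernel Q -> 0 <= g < 1 -> 0 <= b ->
  (forall s a, 0 <= r s a <= b) -> is_opt g Q r V ->
  forall s, 0 <= V s <= b / (1 - g).
Proof.
move=> hQ hg b0 hr hV s.
have /choice[pi hpi] : forall s, exists a, V s = r s a + g * \sum_y Q s a y * V y.
  by move=> x; have [] := hV x.
by rewrite (is_opt_disc_value hQ hg hV hpi); exact: disc_value_bounds.
Qed.
End Discounted.

(** * Gain and bias *)

Section Poisson.
Variables (R : realType) (S : finType).
Implicit Types (M : S -> S -> R) (f u v q : S -> R).

(** Iterating the hypothesis gives [N q <= M^N u - u], and the right side stays bounded in [N]. *)
Lemma no_drift M q u : stochastic M -> app M q =1 q ->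
  (forall s, q s <= app M u s - u s) -> forall s, q s <= 0.
Proof.
move=> hM hq hu s; rewrite leNgt; apply/negP => q0.
have hW := stochasticW hM.
have step N x : N%:R * q x <= mpow M N u x - u x.
  elim: N x => [|N IH] x; first by rewrite mul0r subrr.
  rewrite mpowS; have : app M (fun y => N%:R * q y) x <= app M (fun y => mpow M N u y - u y) x.
    exact: le_app.
  rewrite appZ appB hq -natr1 mulrDl mul1r; have := hu x; lra.
have [b b0 hb] := fun_ub u.
have [N] : exists N : nat, 2 * b < N%:R * q s.
  exists (Num.truncn (2 * b / q s)).+1.
  by rewrite -ltr_pdivrMr // truncnS_gt.
have := step N s; have := mpow_norm N hW b0 hb s; have := hb s.
by rewrite !ler_norml => /andP[? ?] /andP[? ?]; lra.
Qed.

Lemma no_drift_eq M q u : stochastic M -> app M q =1 q ->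
  (forall s, q s = app M u s - u s) -> forall s, q s = 0.
Proof.
move=> hM hq hu s; apply/eqP; rewrite eq_le.
rewrite (@no_drift M q u) //=; last by move=> x; rewrite hu.
rewrite -oppr_le0 (@no_drift M (fun x => - q x) (fun x => - u x)) //.
  by move=> x; rewrite appN hq.
by move=> x; rewrite appN hu; lra.
Qed.

(* By [no_drift_eq] the kernel and the image of I - M meet trivially, so that
   I - M and its square have the same image. *)
Lemma poisson_decomposition M f : stochastic M ->
  exists rho h, app M rho =1 rho /\ forall s, f s = rho s + h s - app M h s.
Proof.
move=> hM; pose n := #|S|.
(* [B] is the transpose of [I - M]: multiplying a row vector by [B] on the right is [I - M] acting
   on functions. *)
pose B : 'M[R]_n := \matrix_(i, j) ((i == j)%:R - M (enum_val j) (enum_val i)).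
pose row u : 'rV[R]_n := \row_i u (enum_val i).
pose fn (v : 'rV[R]_n) : S -> R := fun s => v 0 (enum_rank s).
have rowB (v : 'rV[R]_n) s : (v *m B) 0 (enum_rank s) = fn v s - app M (fn v) s.
  rewrite mxE (reindex _ (onW_bij _ (@enum_rank_bij S))) /=.
  transitivity (\sum_y ((if y == s then fn v y else 0) - M s y * fn v y)).
    apply: eq_bigr => y _; rewrite mxE !enum_rankK (inj_eq enum_rank_inj) /fn.
    by case: eqP => _ /=; ring.
  by rewrite sumrB -big_mkcond /= big_pred1_eq.
have fnE (v : 'rV[R]_n) s : fn (v *m B) s = fn v s - app M (fn v) s by exact: rowB.
have cap0 : (B :&: kermx B)%MS = 0.
  apply/eqP/rowV0P => v; rewrite sub_capmx => /andP[/submxP[D ->] /sub_kermxP h].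
  apply/rowP => i; rewrite [RHS]mxE -[i]enum_valK.
  apply: (@no_drift_eq M (fn (D *m B)) (fun x => - fn D x)) => // [s|s].
    have : fn (D *m B *m B) s = 0 by rewrite h /fn mxE.
    by rewrite fnE => /eqP; rewrite subr_eq0 => /eqP.
  by rewrite fnE appN; lra.
(* Multiplying the row space of [B] by [B] loses exactly the rank of its intersection with the
   kernel, which is zero. *)
have hBB : (B <= B *m B)%MS.
  rewrite -(mxrank_leqif_sup (submxMl B B)).2.
  by rewrite -[X in _ == X](mxrank_mul_ker B B) cap0 mxrank0 addn0.
have /submxP[D hD] : (row f *m B <= B *m B)%MS by exact: submx_trans (submxMl _ _) hBB.
have efn : fn (row f) = f by apply/funext => s; rewrite /fn mxE enum_rankK.
pose h := fn D; exists (fun s => f s - (h s - app M h s)), h; split; last first.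
  by move=> s; lra.
move=> s; have : fn (row f *m B) s = fn (D *m B *m B) s by rewrite hD mulmxA.
rewrite fnE efn fnE fnE (eq_app _ _ (fun s => fnE D s)) appB => e.
by rewrite appB appB; move: e; rewrite -/h; lra.
Qed.

(** Each summand is [M^t h - M^(t+1) h], so the sum telescopes. *)
Lemma sum_mpow_poisson M f rho h (N : nat) s : app M rho =1 rho ->
  (forall s, f s = rho s + h s - app M h s) ->
  \sum_(t < N) (mpow M t f s - rho s) = h s - mpow M N h s.
Proof.
move=> hrho hf.
have mrho t x : mpow M t rho x = rho x.
  by elim: t x => //= t IH x; rewrite (eq_app _ _ IH) hrho.
elim: N => [|N IH]; first by rewrite big_ord0 subrr.
rewrite big_ord_recr IH /=.
have -> : mpow M N f s = mpow M N (fun x => rho x + (h x - app M h x)) s.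
  by apply: eq_mpow => x; rewrite hf; lra.
by rewrite mpowD mpowB mrho -mpowSr mpowS; lra.
Qed.

Lemma cesaro_mean_cvg M f rho h s : stochastic M -> app M rho =1 rho ->
  (forall s, f s = rho s + h s - app M h s) ->
  (fun N : nat => N%:R^-1 * \sum_(k < N) mpow M k f s) @ \oo --> rho s.
Proof.
move=> hM hrho hf; have [b b0 hb] := fun_ub h.
have cu : (fun N : nat => N%:R^-1 * (h s - mpow M N h s)) @ \oo --> (0 : R).
  apply: (@cvg_mean0 _ _ (b + b)) => N; apply: le_trans (ler_normB _ _) _.
  by rewrite lerD // (mpow_norm _ (stochasticW hM) b0).
have c1 : (fun N : nat => rho s + N%:R^-1 * (h s - mpow M N h s)) @ \oo --> rho s.
  by rewrite -[X in _ --> X]addr0; apply: cvgD cu; exact: cvg_cst.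
apply: cvg_trans c1; apply: near_eq_cvg; near=> N.
have N0 : (0 < N)%N by near: N; exists 1%N.
rewrite -(sum_mpow_poisson N _ hrho hf) sumrB sumr_const card_ord mulrBr.
rewrite -[rho s *+ N]mulr_natl mulKf ?pnatr_eq0 -?lt0n //.
by rewrite addrC subrK.
Unshelve. all: end_near. Qed.

Lemma cesaro_lim_poisson M f rho h s : stochastic M -> app M rho =1 rho ->
  (forall s, f s = rho s + h s - app M h s) ->
  cesaro_lim (fun t => mpow M t f s) = rho s.
Proof. by move=> hM hrho hf; apply: cvg_lim => //; exact: cesaro_mean_cvg hf. Qed.

(** The partial sums equal [h - M^T h], and the Cesaro limit of [M^T h] is the harmonic part of [h].
    This is why [h] itself is decomposed a second time. *)
Lemma cesaro_lim_bias M f rho h rho' h' s : stochastic M -> app M rho =1 rho ->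
  (forall s, f s = rho s + h s - app M h s) ->
  app M rho' =1 rho' -> (forall s, h s = rho' s + h' s - app M h' s) ->
  cesaro_lim (fun T => \sum_(t < T) (mpow M t f s - rho s)) = h s - rho' s.
Proof.
move=> hM hrho hf hrho' hh; apply: cvg_lim => //.
have c1 : (fun N : nat => h s - N%:R^-1 * \sum_(k < N) mpow M k h s) @ \oo --> h s - rho' s.
  by apply: cvgB; [exact: cvg_cst | exact: cesaro_mean_cvg hh].
apply: cvg_trans c1; apply: near_eq_cvg; near=> N.
have N0 : (0 < N)%N by near: N; exists 1%N.
under [in RHS]eq_bigr do rewrite (sum_mpow_poisson _ _ hrho hf).
rewrite sumrB sumr_const card_ord mulrBr.
by rewrite -[h s *+ N]mulr_natl mulKf ?pnatr_eq0 -?lt0n.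
Unshelve. all: end_near. Qed.
End Poisson.

Section GainBias.
Variables (R : realType) (S A : finType).
Implicit Types (Q : S -> A -> S -> R) (r : S -> A -> R) (pi : S -> A).

Lemma gain_bias_poisson Q r pi : is_kernel Q ->
  app (Ppi Q pi) (gain Q r pi) =1 gain Q r pi /\
  forall s, gain Q r pi s + bias Q r pi s =
            rpi r pi s + app (Ppi Q pi) (bias Q r pi) s.
Proof.
move=> hQ; have hM := kernel_Ppi pi hQ.
have [rho [h [hrho hf]]] := poisson_decomposition (rpi r pi) hM.
have [rho' [h' [hrho' hh]]] := poisson_decomposition h hM.
have eg : gain Q r pi = rho.
  by apply/funext => s; exact: cesaro_lim_poisson hf.
have eb : bias Q r pi = fun s => h s - rho' s.
  by apply/funext => s; rewrite /bias eg; exact: cesaro_lim_bias hh.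
rewrite eg eb; split => // s; rewrite appB hrho' hf; lra.
Qed.

Lemma spn_ge (v : S -> R) s s' : v s - v s' <= spn v.
Proof.
apply: le_trans (le_bigmax_cond _ _ (isT : xpredT s)).
by apply: le_trans (le_bigmax_cond _ _ (isT : xpredT s')).
Qed.

Lemma spn_le (v : S -> R) b : 0 <= b -> (forall s s', v s - v s' <= b) -> spn v <= b.
Proof.
by move=> b0 h; apply: bigmax_le => // s _; apply: bigmax_le => // s' _.
Qed.

Lemma spn_ge0 (v : S -> R) : 0 <= spn v.
Proof. exact: bigmax_ge_id. Qed.

Lemma gain01 Q r pi : is_kernel Q -> (forall s a, 0 <= r s a <= 1) ->
  forall s, 0 <= gain Q r pi s <= 1.
Proof.
move=> hQ hr s; have hM := kernel_Ppi pi hQ.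
have [hg hb] := gain_bias_poisson r pi hQ.
apply/andP; split.
  rewrite -oppr_le0; apply: (@no_drift _ _ (Ppi Q pi) (fun s => - gain Q r pi s)
    (fun s => - bias Q r pi s)) => // x; first by rewrite appN hg.
  by rewrite appN; have := hb x; have /andP[] := hr x (pi x); rewrite /rpi; lra.
rewrite -subr_le0; apply: (@no_drift _ _ (Ppi Q pi) (fun s => gain Q r pi s - 1)
    (bias Q r pi)) => // x; first by rewrite appB hg app_cst.
by have := hb x; have /andP[] := hr x (pi x); rewrite /rpi; lra.
Qed.

(** The remainder [F] left after subtracting [rho / (1 - g) + b - min b] from the value solves a
    discounted equation with source [-(1 - g) (M b - min b)], so it lies between [- spn b] and 0. *)
Lemma disc_value_gain g Q r pi : is_kernel Q -> 0 <= g < 1 -> forall s,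
  `|disc_value g Q r pi s - gain Q r pi s / (1 - g)| <= spn (bias Q r pi).
Proof.
move=> hQ hg s; have hM := kernel_Ppi pi hQ; have /andP[g0 g1] := hg.
have [hrho hb] := gain_bias_poisson r pi hQ.
set rho := gain Q r pi in hrho hb *; set b := bias Q r pi in hb *.
have [m _ hm] := @Order.TotalTheory.arg_minP _ _ _ s xpredT b isT.
have hW := is_kernelW hQ.
have g1' : 1 - g != 0 by rewrite subr_eq0 eq_sym lt_eqF.
pose V := disc_value g Q r pi.
pose F x := V x - (1 - g)^-1 * rho x - (b x - b m).
have eF x : F x = g * app (Ppi Q pi) F x - (1 - g) * (app (Ppi Q pi) b x - b m).
  rewrite /F (appB _ (fun y => V y - (1 - g)^-1 * rho y)) (appB _ V) appZ hrho.
  rewrite (appB _ b) app_cst // {1}/V disc_valueE //.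
  have -> : rpi r pi x = rho x + b x - app (Ppi Q pi) b x by rewrite hb; lra.
  by field.
have bm x : 0 <= b x - b m <= spn b by rewrite spn_ge subr_ge0 hm.
have ab x : 0 <= app (Ppi Q pi) b x - b m <= spn b.
  rewrite -[b m](app_cst (b m) x hM) -appB app_ge_stoch //=; last first.
    by move=> y; have /andP[] := bm y.
  by apply: app_le_stoch => // y; have /andP[] := bm y.
have F0 x : F x <= 0.
  apply: (@max_principle0 _ _ (Ppi Q pi) g) => //; first exact: stochasticW.
  move=> y; rewrite eF gerBl mulr_ge0 //; first by rewrite subr_ge0 ltW.
  by have /andP[] := ab y.
have F1 x : - F x <= spn b.
  have := @max_principle _ _ (Ppi Q pi) g (fun y => - F y) ((1 - g) * spn b)
    (stochasticW hM) hg; rewrite mulrAC divff // mul1r; apply.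
    by rewrite mulr_ge0 ?spn_ge0 // subr_ge0 ltW.
  move=> y; rewrite appN {1}eF opprB addrC mulrN lerD2l ler_wpM2l //.
    by rewrite subr_ge0 ltW.
  by have /andP[] := ab y.
have := F0 s; have := F1 s; have /andP[] := bm s.
rewrite /F -/V [rho s / _]mulrC ler_norml => h1 h2 h3 h4; apply/andP; split; lra.
Qed.

(** [(1 - g) V - gain] has the form [M u - u] with [u = g V - bias], so [no_drift] applies. In
    contrast with the two-sided estimate, no span of the bias appears; for [pihat] in the unanchored
    model that span is not controlled. *)
Lemma gain_ge_disc_value g Q r pi m : is_kernel Q -> 0 <= g < 1 ->
  (forall s, m <= disc_value g Q r pi s) -> forall s, (1 - g) * m <= gain Q r pi s.
Proof.
move=> hQ hg hm s; have hM := kernel_Ppi pi hQ; have /andP[g0 g1] := hg.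
have [hrho hb] := gain_bias_poisson r pi hQ.
rewrite -subr_le0.
apply: (@no_drift _ _ (Ppi Q pi) (fun x => (1 - g) * m - gain Q r pi x)
  (fun x => g * disc_value g Q r pi x - bias Q r pi x)) => // x.
  by rewrite appB app_cst // hrho.
rewrite appB appZ; have := disc_valueE r pi x (is_kernelW hQ) hg.
have := hb x; have := hm x.
by rewrite -subr_ge0 => /(mulr_ge0 (_ : 0 <= 1 - g)); rewrite subr_ge0 ltW // => /(_ isT); lra.
Qed.
End GainBias.

(** * Weakly communicating processes *)

Section Recurrence.
Variables (R : realType) (S : finType).
Implicit Types (M : S -> S -> R).

Lemma taboo_substochastic M s : stochastic M -> substochastic (taboo M s).
Proof.
move=> hM x; split => [y|]; first by rewrite /taboo; case: eqP => // _; exact: (hM x).1.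
rewrite -(hM x).2; apply: ler_sum => y _; rewrite /taboo; case: eqP => // _.
exact: (hM x).1.
Qed.

(** Only the times 1, 2, ... are constrained, so at [x = s] this is the probability of never
    returning. *)
Definition avoid_prob M s : S -> R := fun x => limn (fun N => mpow (taboo M s) N (fun=> 1) x).

Lemma taboo_exit M s x : stochastic M -> M x s = 1 - app (taboo M s) (fun=> 1) x.
Proof.
move=> hM; rewrite -[X in X - _](hM x).2 /app /taboo (bigD1 s) //= [X in _ - X](bigD1 s) //=.
rewrite eqxx mul0r add0r [X in _ - X](eq_bigr (M x)) ?addrK // => y /negbTE ->.
by rewrite /= mulr1.
Qed.

Lemma sum_first_return M s x (N : nat) : stochastic M ->
  \sum_(t < N) mpow (taboo M s) t (fun y => M y s) x = 1 - mpow (taboo M s) N (fun=> 1) x.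
Proof.
move=> hM; elim: N => [|N IH]; first by rewrite big_ord0 subrr.
have e : M^~ s =1 (fun y => 1 - app (taboo M s) (fun=> 1) y) by move=> y; exact: taboo_exit.
rewrite big_ord_recr IH /= (eq_mpow _ N e).
by rewrite mpowB -mpowSr mpowS; lra.
Qed.

Lemma mpow_taboo_ge0 M s N x : stochastic M -> 0 <= mpow (taboo M s) N (fun=> 1) x.
Proof.
move=> hM; elim: N x => [|N IH] x; first exact: ler01.
by apply: sumr_ge0 => y _; rewrite mulr_ge0 ?IH // (taboo_substochastic s hM x).1.
Qed.

Lemma avoid_prob_cvg M s x : stochastic M ->
  (fun N => mpow (taboo M s) N (fun=> 1) x) @ \oo --> avoid_prob M s x.
Proof.
move=> hM; apply: nonincreasing_is_cvgn.
  apply/nonincreasing_seqP => N; rewrite mpowSr; apply: mpow_le.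
    exact: taboo_substochastic.
  by move=> y; apply: app_le => //; exact: taboo_substochastic.
by exists 0 => _ [N _ <-]; exact: mpow_taboo_ge0.
Qed.

Lemma avoid_probE M s x : stochastic M ->
  avoid_prob M s x = app (taboo M s) (avoid_prob M s) x.
Proof.
move=> hM; have c1 := @avoid_prob_cvg M s x hM.
rewrite -(cvg_shiftS (fun N => mpow (taboo M s) N (fun=> 1) x)) in c1.
have c2 : (fun N => mpow (taboo M s) N.+1 (fun=> 1) x) @ \oo -->
    app (taboo M s) (avoid_prob M s) x.
  exact: (@cvg_mx_app _ _ (taboo M s) (fun N => mpow (taboo M s) N (fun=> 1)) _ x (fun y => @avoid_prob_cvg M s y hM)).
exact: (cvg_unique _ c1 c2).
Qed.

Lemma return_probE M s : stochastic M -> return_prob M s = 1 - avoid_prob M s s.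
Proof.
move=> hM; rewrite /return_prob; apply: cvg_lim => //.
have -> : (fun N => \sum_(t < N) mpow (taboo M s) t (M^~ s) s) =
    (fun N => 1 - mpow (taboo M s) N (fun=> 1) s).
  by apply/funext => N; rewrite sum_first_return.
by apply: cvgB; [exact: cvg_cst | exact: avoid_prob_cvg].
Qed.

(** Fix [s] in [F] and maximise over [F] the probability of avoiding [s]. If the maximum is 0, [s]
    is recurrent. If it is positive, it is an average over successors in which [s] counts as 0, so
    every successor of a maximiser is a maximiser other than [s]. The maximisers other than [s] thus
    form a smaller nonempty closed set, and induction applies. *)
Lemma closed_set_recurrent M (F : {set S}) : stochastic M -> F != finset.set0 ->
  (forall x y, x \in F -> 0 < M x y -> y \in F) ->
  exists2 s, s \in F & ~ transient M s.
Proof.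
move=> hM; have [k] := ubnP #|F|; elim: k F => // k IH F hk /finset.set0Pn[s sF] hF.
have [x0 x0F hx0] := @Order.TotalTheory.arg_maxP _ _ _ s (mem F) (avoid_prob M s) sF.
set u := avoid_prob M s in hx0; set m := u x0.
have hmax y : y \in F -> u y <= m by exact: hx0.
have [m0|m0] := leP m 0.
  exists s => //; rewrite /transient return_probE // => h.
  have : u s <= 0 by apply: le_trans m0; exact: hmax.
  by move: h; rewrite -/u; lra.
have key x y : x \in F -> u x = m -> 0 < M x y -> y != s /\ u y = m.
  move=> xF ux Mxy.
  pose w z := m - (if z == s then 0 else u z).
  have w0 z : 0 <= M x z * w z.
    have := (hM x).1 z; rewrite le_eqVlt => /orP[/eqP <-|Mz]; first by rewrite mul0r.
    rewrite mulr_ge0 ?(ltW Mz) // /w; case: eqP => _; first by rewrite subr0 ltW.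
    by rewrite subr_ge0 hmax // (hF x).
  have ws : \sum_z M x z * w z = 0.
    transitivity (m - app (taboo M s) u x); last by rewrite -avoid_probE // -/u ux subrr.
    rewrite /w /app -[m in RHS](app_cst m x hM) /app -sumrB.
    apply: eq_bigr => z _; rewrite mulrBr /taboo; congr (_ - _).
    by case: eqP => _; rewrite ?mulr0 ?mul0r.
  have /eqP : M x y * w y = 0 by exact: (psumr_eq0P (fun z _ => w0 z) ws).
  rewrite mulf_eq0 gt_eqF //= /w; case: (eqVneq y s) => _.
    by rewrite subr0 gt_eqF.
  by rewrite subr_eq0 => /eqP.
pose F' := [set x in F | (x != s) && (u x == m)]%SET.
have [|||s' s'F' hs'] := IH F'.
- rewrite ltnS in hk; apply: leq_trans hk; apply: proper_card; apply/fintype.properP; split.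
    by apply/fintype.subsetP => x; rewrite inE => /andP[].
  by exists s => //; rewrite inE eqxx /= andbF.
- have [y My] : exists y, 0 < M x0 y.
    apply: contrapT => h; have := (hM x0).2; rewrite big1 => [/eqP|y _]; first by rewrite eq_sym oner_eq0.
    by apply/eqP; rewrite eq_le (hM x0).1 andbT leNgt; apply/negP => My; apply: h; exists y.
  apply/finset.set0Pn; exists y; have [ys uy] := key x0 y x0F erefl My.
  by rewrite inE ys uy eqxx (hF x0).
- move=> x y; rewrite !inE => /andP[xF /andP[_ /eqP ux]] Mxy.
  by have [-> ->] := key x y xF ux Mxy; rewrite eqxx (hF x).
by exists s' => //; move: s'F'; rewrite inE => /andP[].
Qed.
End Recurrence.

Section WeaklyCommunicating.
Variables (R : realType) (S A : finType).
Implicit Types (Q : S -> A -> S -> R) (r : S -> A -> R) (pi : S -> A).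

Lemma Pmu_deterministic Q pi :
  Pmu Q (fun s a => (a == pi s)%:R) = Ppi Q pi.
Proof.
apply/funext => x; apply/funext => y; rewrite /Pmu /Ppi (bigD1 (pi x)) //= eqxx mul1r.
by rewrite big1 ?addr0 // => a /negbTE ->; rewrite mul0r.
Qed.

Lemma deterministic_policy pi : is_stat_policy (fun s a => (a == pi s)%:R : R).
Proof.
move=> s; split => [a|]; first exact: ler0n.
by rewrite (bigD1 (pi s)) //= eqxx big1 ?addr0 // => a /negbTE ->.
Qed.

Lemma weakly_communicating_meets Q pi (F : {set S}) (C : {set S}) : is_kernel Q ->
  (forall s, s \notin C -> forall mu, is_stat_policy mu -> transient (Pmu Q mu) s) ->
  F != finset.set0 -> (forall x y, x \in F -> 0 < Ppi Q pi x y -> y \in F) ->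
  exists2 s, s \in F & s \in C.
Proof.
move=> hQ hC F0 hF; have [s sF hs] := closed_set_recurrent (kernel_Ppi pi hQ) F0 hF.
exists s => //; apply: contrapT => /negP sC; apply: hs.
by have := hC s sC _ (deterministic_policy pi); rewrite Pmu_deterministic.
Qed.

(** The set where [u] is minimal is closed under every policy, by superharmonicity; the set where it
    is maximal is closed under [pi]. Both meet [C], and some policy leads from the first to the
    second inside [C], so the maximum equals the minimum. *)
Lemma superharmonic_constant Q pi (u : S -> R) : is_kernel Q -> weakly_communicating Q ->
  (forall s a, \sum_y Q s a y * u y <= u s) -> app (Ppi Q pi) u =1 u ->
  forall s s', u s = u s'.
Proof.
move=> hQ [C [hC1 hC2]] hsup hharm s0.
have hM := kernel_Ppi pi hQ.
have [x1 _ h1] := @Order.TotalTheory.arg_minP _ _ _ s0 xpredT u isT.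
have [x2 _ h2] := @Order.TotalTheory.arg_maxP _ _ _ s0 xpredT u isT.
have hmin y : u x1 <= u y by exact: h1.
have hmax y : u y <= u x2 by exact: h2.
have clmin p x y : u x = u x1 -> 0 < Ppi Q p x y -> u y = u x1.
  move=> ux Mxy; have hMp := kernel_Ppi p hQ.
  have h0 z : 0 <= Ppi Q p x z * (u z - u x1).
    by rewrite mulr_ge0 ?subr_ge0 //; exact: (hMp x).1.
  have hs : \sum_z Ppi Q p x z * (u z - u x1) = 0.
    apply/eqP; rewrite eq_le sumr_ge0 ?andbT //.
    have := appB (Ppi Q p) u (fun=> u x1) x; rewrite app_cst // {1}/app => ->.
    by rewrite subr_le0 -ux; exact: hsup.
  have /eqP := psumr_eq0P (fun z _ => h0 z) hs (isT : xpredT y).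
  by rewrite mulf_eq0 gt_eqF //= subr_eq0 => /eqP.
have clmax x y : u x = u x2 -> 0 < Ppi Q pi x y -> u y = u x2.
  move=> ux Mxy.
  have h0 z : 0 <= Ppi Q pi x z * (u x2 - u z).
    by rewrite mulr_ge0 ?subr_ge0 //; exact: (hM x).1.
  have hs : \sum_z Ppi Q pi x z * (u x2 - u z) = 0.
    have := appB (Ppi Q pi) (fun=> u x2) u x; rewrite app_cst // {1}/app => ->.
    by rewrite hharm ux subrr.
  have /eqP := psumr_eq0P (fun z _ => h0 z) hs (isT : xpredT y).
  by rewrite mulf_eq0 gt_eqF //= subr_eq0 => /eqP.
have [||c1] := @weakly_communicating_meets Q pi [set x | u x == u x1]%SET C hQ hC1.
- by apply/finset.set0Pn; exists x1; rewrite inE.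
- by move=> x y; rewrite !inE => /eqP ux Mxy; rewrite (clmin pi x y).
rewrite inE => /eqP uc1 c1C.
have [||c2] := @weakly_communicating_meets Q pi [set x | u x == u x2]%SET C hQ hC1.
- by apply/finset.set0Pn; exists x2; rewrite inE.
- by move=> x y; rewrite !inE => /eqP ux Mxy; rewrite (clmax x y).
rewrite inE => /eqP uc2 c2C.
have [p [t ht]] := hC2 _ _ c1C c2C.
have : u c2 = u x1.
  have reach k x : u x = u x1 ->
      0 < mpow (Ppi Q p) k (fun y => if y == c2 then 1 else 0) x -> u c2 = u x1.
    elim: k x => [|k IH] x ux /=; first by case: eqP => [<-//|]; rewrite ltxx.
    move=> hpos.
    have [y Hy] : exists y, 0 < Ppi Q p x y * mpow (Ppi Q p) k (fun y => if y == c2 then 1 else 0) y.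
      apply: contrapT => h; move: hpos; rewrite ltNge => /negP; apply.
      by apply: sumr_le0 => y _; rewrite leNgt; apply/negP => Hy; apply: h; exists y.
    have My : 0 < Ppi Q p x y.
      rewrite lt_neqAle (kernel_Ppi p hQ x).1 andbT; apply/eqP => e.
      by move: Hy; rewrite -e mul0r ltxx.
    by apply: (IH y); [exact: clmin ux My | rewrite -(pmulr_rgt0 _ My)].
  exact: (reach t c1).
rewrite uc2 => e s'; apply/eqP; rewrite eq_le.
by rewrite (le_trans (hmax s0)) ?e ?hmin // (le_trans (hmax s')) ?e ?hmin.
Qed.

(** Multiply the discounted Bellman inequality by [1 - g] and let [g] tend to 1: the value is
    [gain / (1 - g)] up to the span of the bias, which disappears in the limit. *)
Lemma blackwell_gain_superharmonic Q r pi : is_kernel Q ->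
  (forall s a, 0 <= r s a) -> blackwell_optimal Q r pi ->
  forall s a, \sum_y Q s a y * gain Q r pi y <= gain Q r pi s.
Proof.
move=> hQ hr hpi s a; have [gb /andP[gb0 gb1] hb] := blackwell_bellman (is_kernelW hQ) hpi.
pose K := spn (bias Q r pi); pose q := \sum_y Q s a y * gain Q r pi y.
have K0 : 0 <= K by exact: spn_ge0.
have bound g : gb <= g < 1 -> q - gain Q r pi s <= (1 - g) * (q + 2 * K).
  move=> /andP[g0 g1]; have hg : 0 <= g < 1 by rewrite g1 (le_trans gb0).
  have g1' : 0 < 1 - g by rewrite subr_gt0.
  have e1 x := disc_value_gain r pi hQ hg x.
  have e2 : g * \sum_y Q s a y * (gain Q r pi y / (1 - g) - K) <= gain Q r pi s / (1 - g) + K.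
    have := hb g _ s a; rewrite g0 g1 => /(_ isT) h.
    have : disc_value g Q r pi s <= gain Q r pi s / (1 - g) + K.
      by have := e1 s; rewrite ler_norml => /andP[]; rewrite -/K; lra.
    apply: le_trans; apply: le_trans h; rewrite -[leLHS]add0r lerD //.
    rewrite ler_wpM2l //; first by case/andP: hg.
    apply: ler_sum => y _; rewrite ler_wpM2l ?(hQ s a).1 //.
    by have := e1 y; rewrite ler_norml => /andP[]; rewrite -/K; lra.
  move: e2; have -> : \sum_y Q s a y * (gain Q r pi y / (1 - g) - K) = q / (1 - g) - K.
    rewrite /q mulr_suml -[K in RHS]mul1r -(hQ s a).2 mulr_suml -sumrB.
    by apply: eq_bigr => y _; ring.
  rewrite -(ler_pM2l g1') => h.
  have -> : (1 - g) * (q + 2 * K) = (1 - g) * q + (1 - g) * K + (1 - g) * K by ring.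
  move: h; rewrite -subr_ge0; set t1 := (_ - _ : R).
  have -> : t1 = gain Q r pi s - g * q + (1 - g) * K + g * ((1 - g) * K).
    by rewrite /t1; field; rewrite lt0r_neq0.
  have : g * ((1 - g) * K) <= (1 - g) * K.
    by rewrite ler_piMl ?(ltW g1) // mulr_ge0 // ltW.
  by lra.
rewrite -subr_le0 -/q; apply/ler_addgt0Pr => e e0; rewrite add0r.
pose L := `|q + 2 * K| + 1; have L0 : 0 < L by rewrite ltr_wpDl.
pose g := Num.max gb (1 - e / L).
have g1 : g < 1 by rewrite gt_max gb1 /= gtrBl divr_gt0.
have hg : gb <= g < 1 by rewrite g1 le_max lexx.
apply: (le_trans (bound g hg)).
have : 1 - g <= e / L by have : 1 - e / L <= g; [rewrite le_max lexx orbT | lra].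
move=> h; apply: (@le_trans _ _ ((1 - g) * L)).
  rewrite ler_wpM2l ?subr_ge0 ?(ltW g1) // (le_trans (ler_norm _)) // /L lerDl //.
by rewrite -ler_pdivlMr.
Qed.

Lemma blackwell_gain_constant Q r pi : is_kernel Q -> weakly_communicating Q ->
  (forall s a, 0 <= r s a) -> blackwell_optimal Q r pi ->
  forall s s', gain Q r pi s = gain Q r pi s'.
Proof.
move=> hQ hw hr hpi; apply: (superharmonic_constant (pi := pi) hQ hw).
  exact: blackwell_gain_superharmonic.
exact: (gain_bias_poisson r pi hQ).1.
Qed.
End WeaklyCommunicating.

(** * Anchored kernels *)

Section Anchor.
Variables (R : realType) (S A : finType).
Implicit Types (Q : S -> A -> S -> R) (r : S -> A -> R) (pi : S -> A).

Lemma anchor_sum eta s0 Q s a (u : S -> R) :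
  \sum_y anchor eta s0 Q s a y * u y = (1 - eta) * (\sum_y Q s a y * u y) + eta * u s0.
Proof.
rewrite /anchor mulr_sumr; transitivity
  (\sum_y ((1 - eta) * (Q s a y * u y) + eta * (if y == s0 then u y else 0))).
  by apply: eq_bigr => y _; case: eqP => _ /=; ring.
by rewrite big_split -!mulr_sumr -big_mkcond big_pred1_eq.
Qed.

Lemma app_anchor eta s0 Q pi u s :
  app (Ppi (anchor eta s0 Q) pi) u s = (1 - eta) * app (Ppi Q pi) u s + eta * u s0.
Proof. exact: anchor_sum. Qed.

Lemma anchor_kernel eta s0 Q : 0 <= eta <= 1 -> is_kernel Q ->
  is_kernel (anchor eta s0 Q).
Proof.
move=> /andP[e0 e1] hQ s a; split => [y|].
  by rewrite /anchor addr_ge0 ?mulr_ge0 ?subr_ge0 ?ler0n ?(hQ s a).1.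
have := anchor_sum eta s0 Q s a (fun=> 1); under eq_bigr do rewrite mulr1.
move=> ->; under eq_bigr do rewrite mulr1.
by rewrite (hQ s a).2; ring.
Qed.

(** A reset to [s0] contributes the same amount from every state, so it enters the gain and bias
    equations only as a constant. What remains contracts at rate [1 - eta], which forces the gain,
    and then bias minus value, to be constant. *)
Lemma spn_bias_anchor eta s0 Q r pi : 0 < eta <= 1 -> is_kernel Q ->
  spn (bias (anchor eta s0 Q) r pi) = spn (disc_value (1 - eta) Q r pi).
Proof.
move=> /andP[e0 e1] hQ.
have hg : 0 <= 1 - eta < 1 by apply/andP; split; lra.
have hK : is_kernel (anchor eta s0 Q) by apply: anchor_kernel; rewrite ?(ltW e0).
have hM := stochasticW (kernel_Ppi pi hQ).
have [hrho hb] := gain_bias_poisson r pi hK.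
set rho := gain _ r pi in hrho hb; set b := bias _ r pi in hb *.
pose V := disc_value (1 - eta) Q r pi.
have rho_cst s : rho s = rho s0.
  apply/eqP; rewrite -subr_eq0; apply/eqP.
  apply: (@max_principle_eq _ _ (Ppi Q pi) (1 - eta) (fun s => rho s - rho s0)) => // x.
  rewrite appB app_cst; last exact: kernel_Ppi.
  by have := hrho x; rewrite app_anchor; lra.
have bV s : b s - V s = b s0 - rho s0 / eta.
  apply/eqP; rewrite -subr_eq0; apply/eqP.
  apply: (@max_principle_eq _ _ (Ppi Q pi) (1 - eta)
    (fun s => (b s - V s) - (b s0 - rho s0 / eta))) => // x.
  rewrite (appB _ (fun y => b y - V y)) (appB _ b) app_cst; last exact: kernel_Ppi.
  have := hb x; rewrite app_anchor rho_cst => h.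
  have hV := disc_valueE r pi x (is_kernelW hQ) hg; rewrite -/V in hV.
  have : b x = rpi r pi x + (1 - eta) * app (Ppi Q pi) b x + eta * b s0 - rho s0 by lra.
  move=> ->; rewrite hV; have : rho s0 / eta * eta = rho s0 by rewrite divfK ?gt_eqF.
  by set t := rho s0 / eta; move=> <-; ring.
rewrite /spn -/V; apply: eq_bigr => s _; apply: eq_bigr => s' _.
by have := bV s; have := bV s'; lra.
Qed.

(** The second equation is what eliminates the reset term from the Bellman inequalities of the
    anchored model. *)
Lemma disc_value_anchor eta s0 Q r pi g : 0 < eta <= 1 -> is_kernel Q -> 0 <= g < 1 ->
  exists c, (forall s, disc_value g (anchor eta s0 Q) r pi s =
                       disc_value (g * (1 - eta)) Q r pi s + c) /\
    (1 - g * (1 - eta)) * c = g * eta * disc_value g (anchor eta s0 Q) r pi s0.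
Proof.
move=> /andP[e0 e1] hQ hg; have /andP[g0 g1] := hg.
have hb : 0 <= g * (1 - eta) < 1.
  rewrite mulr_ge0 ?subr_ge0 //= (le_lt_trans _ g1) // ler_piMr //; lra.
have hK : is_kernel (anchor eta s0 Q) by apply: anchor_kernel; rewrite ?(ltW e0).
have hM := stochasticW (kernel_Ppi pi hQ).
set V := disc_value g _ r pi; pose W := disc_value (g * (1 - eta)) Q r pi.
pose c := g * eta * V s0 / (1 - g * (1 - eta)).
have hc : (1 - g * (1 - eta)) * c = g * eta * V s0.
  by rewrite mulrC /c divfK // subr_eq0 eq_sym lt_eqF //; case/andP: hb.
exists c; split => // s; apply/eqP; rewrite -subr_eq0; apply/eqP.
apply: (@max_principle_eq _ _ (Ppi Q pi) (g * (1 - eta)) (fun s => V s - (W s + c))) => // x.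
rewrite (appB _ V) appD app_cst; last exact: kernel_Ppi.
have hV := disc_valueE r pi x (is_kernelW hK) hg; rewrite -/V app_anchor in hV.
have hW := disc_valueE r pi x (is_kernelW hQ) hb; rewrite -/W in hW.
by rewrite hV hW; move: hc; rewrite !(mulrDr, mulrDl, mulrBr, mulrBl); lra.
Qed.

(** The value for [g'] solves the equation for discount [h] up to the residual [(g' - h) M V]. Only
    discounts below [g'] occur later, as products [g * (1 - eta)]. *)
Lemma disc_value_lip_discount g g' Q r pi : is_kernel Q -> 0 <= g <= g' -> g' < 1 ->
  exists2 K, 0 <= K & forall h, 0 <= h <= g' -> forall s,
    `|disc_value h Q r pi s - disc_value g' Q r pi s| <= K * (g' - h).
Proof.
move=> hQ /andP[g0 gg'] g'1.
have hM := stochasticW (kernel_Ppi pi hQ).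
have [b b0 hb] := fun_ub (app (Ppi Q pi) (disc_value g' Q r pi)).
have g'1' : 0 < 1 - g' by rewrite subr_gt0.
exists (b / (1 - g')); first by rewrite divr_ge0 // ltW.
move=> h /andP[h0 hg'] s.
have hh : 0 <= h < 1 by rewrite h0 (le_lt_trans hg').
have hhg : 0 <= g' < 1 by rewrite g'1 (le_trans h0).
apply: (@le_trans _ _ (b * (g' - h) / (1 - h))).
  apply: (@max_principle_norm _ _ (Ppi Q pi) h
    (fun s => disc_value h Q r pi s - disc_value g' Q r pi s)) => //.
    by rewrite mulr_ge0 // subr_ge0.
  move=> x; rewrite appB (disc_valueE r pi x (is_kernelW hQ) hh).
  rewrite [disc_value g' Q r pi x](disc_valueE r pi x (is_kernelW hQ) hhg).
  set u := app _ (disc_value h _ _ _) _; set v := app _ (disc_value g' _ _ _) _.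
  have -> : rpi r pi x + h * u - (rpi r pi x + g' * v) - h * (u - v) = - (v * (g' - h)) by ring.
  rewrite normrN normrM (ger0_norm (_ : 0 <= g' - h)) ?subr_ge0 //.
  by rewrite ler_wpM2r ?subr_ge0 // hb.
rewrite -mulrA -mulrA [_^-1 * _]mulrC; apply: ler_wpM2l => //.
apply: ler_wpM2l; first by rewrite subr_ge0.
by rewrite lef_pV2 ?posrE ?subr_gt0 //; [lra | case/andP: hh].
Qed.

(* In the anchored chain, discounting by g acts as discounting the original
   chain by g (1 - eta), up to an additive constant; let g tend to 1. *)
Lemma blackwell_anchor_opt eta s0 Q r pi : 0 < eta <= 1 -> is_kernel Q ->
  blackwell_optimal (anchor eta s0 Q) r pi ->
  is_opt (1 - eta) Q r (disc_value (1 - eta) Q r pi).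
Proof.
move=> heta hQ hpi; have /andP[e0 e1] := heta.
have hW := is_kernelW hQ.
have hg : 0 <= 1 - eta < 1 by apply/andP; split; lra.
have hK : is_kernel (anchor eta s0 Q) by apply: anchor_kernel; rewrite ?(ltW e0).
have [gb /andP[gb0 gb1] hb] := blackwell_bellman (is_kernelW hK) hpi.
set G := 1 - eta in hg *.
move=> s; split => [a|]; last by exists (pi s); rewrite disc_valueE.
have bellG g : gb <= g < 1 -> r s a + g * G * \sum_y Q s a y * disc_value (g * G) Q r pi y
    <= disc_value (g * G) Q r pi s.
  move=> hg1; have hg0 : 0 <= g < 1 by case/andP: hg1 => h ->; rewrite (le_trans gb0).
  have [c [hc1 hc2]] := disc_value_anchor s0 r pi heta hQ hg0.
  have := hb g hg1 s a; rewrite anchor_sum.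
  have -> : \sum_y Q s a y * disc_value g (anchor eta s0 Q) r pi y =
      \sum_y Q s a y * disc_value (g * G) Q r pi y + c.
    rewrite -[c in RHS]mul1r -(hQ s a).2 mulr_suml -big_split /=.
    by apply: eq_bigr => y _; rewrite hc1 mulrDr.
  rewrite (hc1 s) -/G; set u := \sum_y _; move: hc2; rewrite -/G => hc2.
  have -> : g * (G * (u + c) + eta * disc_value g (anchor eta s0 Q) r pi s0) =
    g * G * u + g * G * c + g * eta * disc_value g (anchor eta s0 Q) r pi s0 by ring.
  by rewrite -hc2; lra.
have [K K0 hKl] := @disc_value_lip_discount G G Q r pi hQ
  (ltac:(by rewrite lexx andbT; case/andP: hg)) (ltac:(by case/andP: hg)).
have [b b0 hbV] := fun_ub (disc_value G Q r pi).
have G0 : 0 <= G by case/andP: hg.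
have G1 : G < 1 by case/andP: hg.
set V := disc_value G Q r pi in hKl hbV *.
have bound g : gb <= g < 1 -> r s a + G * (\sum_y Q s a y * V y) <= V s + (2 * K + b) * (1 - g).
  move=> hg1; have /andP[hga hgb] := hg1; have g0 := le_trans gb0 hga.
  have gG : 0 <= g * G <= G by rewrite mulr_ge0 //= ler_piMl // ltW.
  have d x := hKl (g * G) gG x.
  have dK : K * (G - g * G) <= K * (1 - g).
    rewrite ler_wpM2l //; have -> : G - g * G = G * (1 - g) by ring.
    by rewrite ler_piMl ?(ltW G1) // subr_ge0 ltW.
  set W := disc_value (g * G) Q r pi in d.
  have := bellG g hg1; rewrite -/W => h1.
  have h2 : W s <= V s + K * (1 - g) by have := d s; rewrite ler_norml => /andP[]; lra.
  have h3 : \sum_y Q s a y * V y <= \sum_y Q s a y * W y + K * (1 - g).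
    move: dK; set k := K * (1 - g) => dK.
    rewrite -[k]mul1r -(hQ s a).2 mulr_suml -big_split /=.
    apply: ler_sum => y _; rewrite -mulrDr ler_wpM2l ?(hQ s a).1 //.
    by have := d y; rewrite ler_norml => /andP[]; lra.
  have h4 : \sum_y Q s a y * V y <= b.
    rewrite -[b]mul1r -(hQ s a).2 mulr_suml; apply: ler_sum => y _.
    by rewrite ler_wpM2l ?(hQ s a).1 // (le_trans (ler_norm _)).
  set u := \sum_y Q s a y * V y in h3 h4 *; set w := \sum_y Q s a y * W y in h1 h3.
  have h5 : g * G * u <= g * G * w + K * (1 - g).
    have gG0 : 0 <= g * G by case/andP: gG.
    have gG1 : g * G <= 1 by case/andP: gG => _ /le_trans; apply; exact: ltW.
    have := ler_wpM2l gG0 h3; have : g * G * (K * (1 - g)) <= K * (1 - g).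
      by rewrite ler_piMl // mulr_ge0 // subr_ge0 ltW.
    lra.
  have h6 : (1 - g) * (G * u) <= (1 - g) * b.
    rewrite ler_wpM2l ?subr_ge0 ?(ltW hgb) //.
    apply: (@le_trans _ _ (G * b)); first by rewrite ler_wpM2l.
    by rewrite ler_piMl // ltW.
  have : G * u = g * G * u + (1 - g) * (G * u) by ring.
  lra.
apply/ler_addgt0Pr => e ep.
pose L := 2 * K + b + 1; have L0 : 0 < L by rewrite /L; lra.
pose g := Num.max gb (1 - e / L).
have g1 : g < 1 by rewrite gt_max gb1 /= gtrBl divr_gt0.
have hg1 : gb <= g < 1 by rewrite g1 le_max lexx.
apply: (le_trans (bound g hg1)); rewrite lerD2l.
have h : 1 - g <= e / L by have : 1 - e / L <= g; [rewrite le_max lexx orbT | lra].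
apply: (@le_trans _ _ (L * (1 - g))).
  by rewrite ler_wpM2r ?subr_ge0 ?(ltW g1) // /L; lra.
by rewrite mulrC -ler_pdivlMr.
Qed.
End Anchor.

(** * Variance and value comparison *)

Section Variance.
Variables (R : realType) (S : finType).
Implicit Types (p f h : S -> R).

Definition mean p f := \sum_y p y * f y.
Definition var p f := \sum_y p y * (f y - mean p f) ^+ 2.
Definition is_pmf p := (forall y, 0 <= p y) /\ \sum_y p y = 1.

Lemma meanD p f h : mean p (fun y => f y + h y) = mean p f + mean p h.
Proof. by rewrite /mean -big_split; apply: eq_bigr => y _; rewrite mulrDr. Qed.

Lemma meanN p f : mean p (fun y => - f y) = - mean p f.
Proof. by rewrite /mean -sumrN; apply: eq_bigr => y _; rewrite mulrN. Qed.

Lemma meanB p f h : mean p (fun y => f y - h y) = mean p f - mean p h.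
Proof. by rewrite meanD meanN. Qed.

Lemma meanZ p f k : mean p (fun y => k * f y) = k * mean p f.
Proof. by rewrite /mean mulr_sumr; apply: eq_bigr => y _; rewrite mulrCA. Qed.

Lemma mean_cst p c : is_pmf p -> mean p (fun=> c) = c.
Proof. by move=> [_ h]; rewrite /mean -mulr_suml h mul1r. Qed.

Lemma eq_mean p f h : f =1 h -> mean p f = mean p h.
Proof. by move=> e; apply: eq_bigr => y _; rewrite e. Qed.

Lemma le_mean p f h : is_pmf p -> (forall y, f y <= h y) -> mean p f <= mean p h.
Proof. by move=> [hp _] fh; apply: ler_sum => y _; rewrite ler_wpM2l. Qed.

Lemma mean_norm p f e : is_pmf p -> (forall y, `|f y| <= e) -> `|mean p f| <= e.
Proof.
move=> hp hf; rewrite ler_norml -{1}(mean_cst (- e) hp) -{2}(mean_cst e hp).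
by rewrite !le_mean // => y; have := hf y; rewrite ler_norml => /andP[].
Qed.

Lemma varE p f : is_pmf p -> var p f = mean p (fun y => f y ^+ 2) - mean p f ^+ 2.
Proof.
move=> hp; have -> : var p f = mean p (fun y => f y ^+ 2 + (- 2 * mean p f) * f y + mean p f ^+ 2).
  by apply: eq_bigr => y _; ring.
by rewrite !meanD meanZ mean_cst //; ring.
Qed.

Lemma var_ge0 p f : is_pmf p -> 0 <= var p f.
Proof. by move=> [hp _]; apply: sumr_ge0 => y _; rewrite mulr_ge0 ?sqr_ge0. Qed.

Lemma var_le_center p f c : is_pmf p -> var p f <= mean p (fun y => (f y - c) ^+ 2).
Proof.
move=> hp; rewrite varE //.
have -> : mean p (fun y => (f y - c) ^+ 2) =
    mean p (fun y => f y ^+ 2 + (- 2 * c) * f y + c ^+ 2).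
  by apply: eq_mean => y; ring.
rewrite !meanD meanZ mean_cst // -subr_ge0.
by rewrite (_ : _ - _ = (mean p f - c) ^+ 2) ?sqr_ge0 //; ring.
Qed.

Lemma var_shift p f c : is_pmf p -> var p (fun y => f y - c) = var p f.
Proof.
move=> hp; rewrite /var meanB mean_cst //; apply: eq_bigr => y _.
by congr (_ * _ ^+ 2); ring.
Qed.

Lemma varD_le p f h : is_pmf p ->
  var p (fun y => f y + h y) <= 2 * var p f + 2 * var p h.
Proof.
move=> hp; rewrite /var meanD !mulr_sumr -[leRHS]big_split /=; apply: ler_sum => y _.
rewrite -subr_ge0 (_ : _ - _ = p y * ((f y - mean p f) - (h y - mean p h)) ^+ 2).
  by rewrite mulr_ge0 ?sqr_ge0 //; exact: hp.1.
by ring.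
Qed.

Lemma var_norm_le p f e : is_pmf p -> (forall y, `|f y| <= e) -> var p f <= e ^+ 2.
Proof.
move=> hp hf; apply: le_trans (var_le_center f 0 hp) _.
rewrite -[leRHS](mean_cst _ hp); apply: le_mean => // y.
by rewrite subr0 -real_normK ?num_real // lerXn2r ?nnegrE // (le_trans _ (hf y)).
Qed.

(** Squaring is [2 b]-Lipschitz on [[0, b]], and the variance is at most the mean square about any
    centre, here [mean p f ^+ 2]. *)
Lemma var_sqr_le p f b : is_pmf p -> (forall y, 0 <= f y <= b) ->
  var p (fun y => f y ^+ 2) <= 4 * b ^+ 2 * var p f.
Proof.
move=> hp hf; apply: le_trans (var_le_center _ (mean p f ^+ 2) hp) _.
rewrite /var mulr_sumr; apply: ler_sum => y _.
rewrite [leRHS]mulrCA; apply: ler_wpM2l; first exact: hp.1.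
have m0 : 0 <= mean p f.
  by rewrite -(mean_cst 0 hp) le_mean // => z; have /andP[] := hf z.
have mb : mean p f <= b.
  by rewrite -[leRHS](mean_cst b hp) le_mean // => z; have /andP[] := hf z.
have /andP[f0 fb] := hf y.
rewrite subr_sqr exprMn mulrC ler_wpM2r ?sqr_ge0 //.
have -> : 4 * b ^+ 2 = (2 * b) ^+ 2 by ring.
by rewrite lerXn2r ?nnegrE; lra.
Qed.
End Variance.

(** * Comparing the values of one policy under two kernels *)

Section Comparison.
Variables (R : realType) (S A : finType).
Implicit Types (Q P Ph : S -> A -> S -> R) (r : S -> A -> R) (pi : S -> A).

(* |D| + 8 lam W^2 is a supersolution: the term g M W^2 - W^2 absorbs the
   accumulated variance without any Cauchy-Schwarz step. *)
Lemma variance_potential (M : S -> S -> R) g (D W u : S -> R) lam tau y :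
  stochastic M -> 0 <= g < 1 -> 0 <= lam -> 0 <= tau -> 0 <= y -> 16 * lam * tau <= 1 ->
  (forall s, 0 <= u s) ->
  (forall s, `|D s| <= g * app M (fun x => `|D x|) s + 4 * lam * u s + y) ->
  (forall s, u s <= g * app M (fun x => W x ^+ 2) s - W s ^+ 2 + 2 * tau +
                    8 * lam * tau * u s + 2 * tau * y) ->
  forall s, `|D s| <= (16 * lam * tau + 2 * y) / (1 - g).
Proof.
move=> hM hg l0 t0 y0 hlt hu hD hW s.
apply: (@le_trans _ _ (`|D s| + 8 * lam * W s ^+ 2)).
  by rewrite lerDl mulr_ge0 ?sqr_ge0 // mulr_ge0.
apply: (@max_principle _ _ M g (fun x => `|D x| + 8 * lam * W x ^+ 2)) => //.
- exact: stochasticW.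
- by rewrite addr_ge0 ?mulr_ge0.
move=> x; rewrite appD appZ.
(* The term [8 lam tau u] is at most half of [u] and is absorbed on the left. *)
have h1 : u x <= 2 * (g * app M (fun x => W x ^+ 2) x - W x ^+ 2 + 2 * tau + 2 * tau * y).
  have : 16 * lam * tau * u x <= u x by rewrite ler_piMl.
  by have := hW x; lra.
have h2 := ler_wpM2l (_ : 0 <= 4 * lam) h1.
have := h2 (mulr_ge0 _ l0); rewrite ler0n => /(_ isT) h3.
have h4 : 16 * lam * tau * y <= y by rewrite ler_piMl.
have := hD x; move: h3; rewrite !(mulrDr, mulrBr); lra.
Qed.

Lemma kernel_pmf Q s a : is_kernel Q -> is_pmf (Q s a).
Proof. by move=> h; exact: h. Qed.

(** Shifting the value by [m] replaces the reward by [r - (1 - g) m]. Since [m] is itself a value,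
    [(1 - g) m] lies in [[0, 1]], and the shifted reward stays bounded by 1 although values are of
    the order of the horizon. *)
Lemma value_shift_residual g Q r pi m s : is_kernel Q -> 0 <= g < 1 ->
  (forall s a, 0 <= r s a <= 1) ->
  (exists s, m = disc_value g Q r pi s) ->
  exists2 k, `|k| <= 1 & disc_value g Q r pi s - m =
    k + g * mean (Q s (pi s)) (fun y => disc_value g Q r pi y - m).
Proof.
move=> hQ hg hr [s1 hm].
have /andP[g0 g1] := hg; have g1' : 0 < 1 - g by rewrite subr_gt0.
have := disc_value_bounds pi (is_kernelW hQ) hg ler01 hr s1.
rewrite -hm => /andP[m0 m1].
exists (rpi r pi s - (1 - g) * m).
  have h2 : (1 - g) * m <= 1 by rewrite mulrC -ler_pdivlMr.
  have h3 : 0 <= (1 - g) * m by rewrite mulr_ge0 // ltW.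
  have /andP[] := hr s (pi s); rewrite /rpi ler_norml => *; apply/andP; split; lra.
rewrite meanB mean_cst; last exact: kernel_pmf.
rewrite [in LHS](disc_valueE r pi s (is_kernelW hQ) hg) /mean /app /Ppi; ring.
Qed.

(** From [g (p W)^2 >= (g p W)^2 = (w - k)^2 >= w^2 - 2 w k]. The variance thereby becomes a
    one-step difference of [W^2], which is the drift fed to [variance_potential]. *)
Lemma variance_residual (p W : S -> R) (g w k tau : R) : is_pmf p -> 0 <= g < 1 ->
  0 <= w <= tau -> w = k + g * mean p W ->
  g * var p W <= g * mean p (fun y => W y ^+ 2) - w ^+ 2 + 2 * tau * `|k|.
Proof.
move=> hp /andP[g0 g1] /andP[w0 wt] hw; rewrite varE // mulrBr.
have h1 : g * (g * mean p W ^+ 2) <= g * mean p W ^+ 2.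
  by rewrite ler_piMl ?(ltW g1) // mulr_ge0 ?sqr_ge0.
have h2 : g * (g * mean p W ^+ 2) = w ^+ 2 - 2 * w * k + k ^+ 2.
  have -> : k = w - g * mean p W by lra.
  by ring.
have h3 : w * k <= tau * `|k|.
  by apply: (le_trans (ler_wpM2l w0 (ler_norm k))); rewrite ler_wpM2r.
by have := sqr_ge0 k; lra.
Qed.

(** The error propagates along [Ph], but the variances and the equation for [W] belong to [P]. The
    drift of [W^2] must therefore be moved from [P] to [Ph], which is the purpose of the second
    deviation bound; its scale is [lam / tau] because [W^2] ranges up to [tau^2]. *)
Lemma value_gap_model g P Ph r pi (m lam tau y : R) :
  let V := disc_value g P r pi in let W := fun x => V x - m in
  is_kernel P -> is_kernel Ph -> 0 <= g < 1 -> (forall s a, 0 <= r s a <= 1) ->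
  (exists s, m = V s) -> (forall s, 0 <= W s <= tau) -> 0 < tau -> 0 <= lam -> 0 <= y ->
  16 * lam * tau <= 1 ->
  (forall s, `|mean (Ph s (pi s)) W - mean (P s (pi s)) W|
      <= 2 * lam * var (P s (pi s)) W + y) ->
  (forall s, `|mean (Ph s (pi s)) (fun x => W x ^+ 2) - mean (P s (pi s)) (fun x => W x ^+ 2)|
      <= 2 * (lam / tau) * var (P s (pi s)) (fun x => W x ^+ 2) + tau * y) ->
  forall s, `|disc_value g Ph r pi s - V s| <= (16 * lam * tau + 2 * y) / (1 - g).
Proof.
move=> V W hP hPh hg hr hm hW t0 l0 y0 hlt hb1 hb2.
have /andP[g0 g1] := hg.
pose u s := g * var (P s (pi s)) W.
have hpm s := kernel_pmf s (pi s) hP.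
apply: (@variance_potential (Ppi Ph pi) g (fun s => disc_value g Ph r pi s - V s) W u) => //.
- exact: kernel_Ppi.
- exact: ltW.
- by move=> s; rewrite mulr_ge0 ?var_ge0.
- move=> s.
  have e : disc_value g Ph r pi s - V s =
      g * app (Ppi Ph pi) (fun x => disc_value g Ph r pi x - V x) s +
      g * (mean (Ph s (pi s)) W - mean (P s (pi s)) W).
    rewrite (disc_valueE r pi s (is_kernelW hPh) hg) /V (disc_valueE r pi s (is_kernelW hP) hg).
    rewrite appB /W !meanB !mean_cst; try exact: kernel_pmf.
    by rewrite -/V /mean /app /Ppi; ring.
  rewrite {1}e; apply: le_trans (ler_normD _ _) _; rewrite -addrA; apply: lerD.
    rewrite normrM (ger0_norm g0) ler_wpM2l //.
    by apply: ler_norm_app; exact: stochasticW (kernel_Ppi _ _).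
  rewrite normrM (ger0_norm g0); apply: le_trans (ler_wpM2l g0 (hb1 s)) _.
  rewrite mulrDr; apply: lerD; last by rewrite ler_piMl // ltW.
  by rewrite /u mulrCA ler_wpM2r ?mulr_ge0 ?var_ge0 //; lra.
move=> s; have [k k1 hk] := value_shift_residual s hP hg hr hm.
have := variance_residual (hpm s) hg (hW s) hk; rewrite -/V -/W -/(u s) => h1.
have h2 : 2 * tau * `|k| <= 2 * tau by rewrite ler_piMr // mulr_ge0 // ltW.
have h3 : g * mean (P s (pi s)) (fun x => W x ^+ 2) <=
    g * mean (Ph s (pi s)) (fun x => W x ^+ 2) + 8 * lam * tau * u s + 2 * tau * y.
  have h4 : 2 * (lam / tau) * var (P s (pi s)) (fun x => W x ^+ 2)
      <= 8 * lam * tau * var (P s (pi s)) W.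
    apply: (@le_trans _ _ (2 * (lam / tau) * (4 * tau ^+ 2 * var (P s (pi s)) W))).
      by rewrite ler_wpM2l ?var_sqr_le // mulr_ge0 // divr_ge0 // ltW.
    rewrite le_eqVlt; apply/orP; left; apply/eqP; field; exact: lt0r_neq0.
  have := hb2 s; rewrite ler_norml => /andP[h5 _].
  have h6 : mean (P s (pi s)) (fun x => W x ^+ 2) <= mean (Ph s (pi s)) (fun x => W x ^+ 2)
      + (8 * lam * tau * var (P s (pi s)) W + tau * y) by lra.
  apply: le_trans (ler_wpM2l g0 h6) _; rewrite mulrDr -addrA lerD2l mulrDr lerD //.
    by rewrite /u mulrCA.
  have ty : 0 <= tau * y by rewrite mulr_ge0 // ltW.
  have : g * (tau * y) <= tau * y by rewrite ler_piMl // ltW.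
  by rewrite -mulrA; lra.
have -> : app (Ppi Ph pi) (fun x => W x ^+ 2) s = mean (Ph s (pi s)) (fun x => W x ^+ 2) by [].
by lra.
Qed.

(** Here error and variance both follow [P], but [W] solves the equation of [Ph]. The model error
    [e] therefore joins the residual [k], and its variance part is absorbed again; a deviation bound
    for [W] alone closes the argument. *)
Lemma value_gap_empirical g P Ph r pi (m lam tau y : R) :
  let V := disc_value g Ph r pi in let W := fun x => V x - m in
  is_kernel P -> is_kernel Ph -> 0 <= g < 1 -> (forall s a, 0 <= r s a <= 1) ->
  (exists s, m = V s) -> (forall s, 0 <= W s <= tau) -> 0 <= lam -> 0 <= y ->
  16 * lam * tau <= 1 ->
  (forall s, `|mean (Ph s (pi s)) W - mean (P s (pi s)) W|
      <= 4 * lam * var (P s (pi s)) W + y) ->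
  forall s, `|V s - disc_value g P r pi s| <= (16 * lam * tau + 2 * y) / (1 - g).
Proof.
move=> V W hP hPh hg hr hm hW l0 y0 hlt hb s0.
have /andP[g0 g1] := hg.
have t0 : 0 <= tau by have /andP[h1 h2] := hW s0; exact: le_trans h2.
pose u s := g * var (P s (pi s)) W.
have hpm s := kernel_pmf s (pi s) hP.
pose e s := g * (mean (Ph s (pi s)) W - mean (P s (pi s)) W).
have eb s : `|e s| <= 4 * lam * u s + y.
  rewrite /e normrM (ger0_norm g0); apply: le_trans (ler_wpM2l g0 (hb s)) _.
  rewrite mulrDr; apply: lerD; last by rewrite ler_piMl // ltW.
  by rewrite /u mulrCA.
apply: (@variance_potential (Ppi P pi) g (fun s => V s - disc_value g P r pi s) W u) => //.
- by move=> s; rewrite mulr_ge0 ?var_ge0.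
- move=> s.
  have e1 : V s - disc_value g P r pi s =
      g * app (Ppi P pi) (fun x => V x - disc_value g P r pi x) s + e s.
    rewrite /V (disc_valueE r pi s (is_kernelW hPh) hg) (disc_valueE r pi s (is_kernelW hP) hg).
    rewrite appB /e /W !meanB !mean_cst; try exact: kernel_pmf.
    by rewrite -/V /mean /app /Ppi; ring.
  rewrite {1}e1; apply: le_trans (ler_normD _ _) _; rewrite -addrA; apply: lerD => //.
  rewrite normrM (ger0_norm g0) ler_wpM2l //.
  by apply: ler_norm_app; exact: stochasticW (kernel_Ppi _ _).
move=> s; have [k k1 hk] := value_shift_residual s hPh hg hr hm.
have hk' : W s = (k + e s) + g * mean (P s (pi s)) W.
  by rewrite /W -/V hk /e -/V -/W; ring.
have := variance_residual (hpm s) hg (hW s) hk'; rewrite -/(u s) => h1.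
have h2 : 2 * tau * `|k + e s| <= 2 * tau + 2 * tau * (4 * lam * u s + y).
  have -> : 2 * tau + 2 * tau * (4 * lam * u s + y) = 2 * tau * (1 + (4 * lam * u s + y)) by ring.
  rewrite ler_wpM2l ?mulr_ge0 //; apply: le_trans (ler_normD _ _) _; exact: lerD.
have -> : app (Ppi P pi) (fun x => W x ^+ 2) s = mean (P s (pi s)) (fun x => W x ^+ 2) by [].
by move: h2; rewrite mulrDr (_ : 2 * tau * (4 * lam * u s) = 8 * lam * tau * u s); [lra | ring].
Qed.

(** Transfers a bound for a sample-independent [f] to a nearby random [V]. Comparing the variances
    costs the factor 2 that turns [2 lam] into [4 lam]; the centres [c] and [c'] cancel. *)
Lemma mean_gap_approx (p ph f V : S -> R) c c' lam y e : is_pmf p -> is_pmf ph ->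
  0 <= lam -> (forall s, `|V s - f s| <= e) ->
  `|mean ph (fun x => f x - c') - mean p (fun x => f x - c')|
    <= 2 * lam * var p (fun x => f x - c') + y ->
  `|mean ph (fun x => V x - c) - mean p (fun x => V x - c)|
    <= 4 * lam * var p (fun x => V x - c) + (4 * lam * e ^+ 2 + 2 * e + y).
Proof.
move=> hp hph l0 he; rewrite !var_shift // !meanB !mean_cst // => hb.
have h1 : `|mean ph (fun x => V x - f x)| <= e by exact: mean_norm.
have h2 : `|mean p (fun x => V x - f x)| <= e by exact: mean_norm.
have h3 : var p f <= 2 * var p V + 2 * e ^+ 2.
  have -> : var p f = var p (fun y => V y + (f y - V y)).
    by congr (var p _); apply/funext => z; lra.
  apply: le_trans (varD_le _ _ hp) _; rewrite lerD2l ler_wpM2l //.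
  by apply: var_norm_le => // z; rewrite distrC.
have h4 := ler_wpM2l (mulr_ge0 (ler0n R 2) l0) h3.
move: h1 h2; rewrite !meanB => h1 h2.
have -> : mean ph V - c - (mean p V - c) =
   (mean ph f - c' - (mean p f - c')) + ((mean ph V - mean ph f) - (mean p V - mean p f)) by ring.
apply: le_trans (ler_normD _ _) _.
have := ler_normB (mean ph V - mean ph f) (mean p V - mean p f).
move: h4; rewrite mulrDr; lra.
Qed.
End Comparison.

(** * Concentration for product weights *)

Section ProductWeight.
Variables (R : realType) (I Y : finType) (mu : I -> Y -> R).
Hypothesis hmu : forall i, is_pmf (mu i).

Definition weight (w : {ffun I -> Y}) : R := \prod_i mu i (w i).
Definition upd (w : {ffun I -> Y}) p y : {ffun I -> Y} :=
  [ffun i => if i == p then y else w i].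

Lemma weight_ge0 w : 0 <= weight w.
Proof. by apply: prodr_ge0 => i _; exact: (hmu i).1. Qed.

Lemma sum_weight : \sum_w weight w = 1.
Proof.
rewrite /weight -(bigA_distr_bigA (fun i y => mu i y)) big1 // => i _; exact: (hmu i).2.
Qed.

Lemma sum_weight_le (h : {ffun I -> Y} -> R) e :
  (forall w, h w <= e) -> \sum_w weight w * h w <= e.
Proof.
move=> he; rewrite -[leRHS]mul1r -sum_weight mulr_suml.
by apply: ler_sum => w _; rewrite ler_wpM2l ?weight_ge0.
Qed.

Lemma weight_upd w p y : weight (upd w p y) * mu p (w p) = weight w * mu p y.
Proof.
rewrite /weight (bigD1 p) //= [in RHS](bigD1 p) //= ffunE eqxx.
rewrite (eq_bigr (fun i => mu i (w i))); first by ring.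
by move=> i /negbTE h; rewrite ffunE h.
Qed.

(* The map (w, y) |-> (upd w p y, w p) is an involution preserving the
   product weight. *)
Lemma resample (g : {ffun I -> Y} -> R) p :
  \sum_w weight w * g w = \sum_w weight w * \sum_y mu p y * g (upd w p y).
Proof.
pose phi (z : {ffun I -> Y} * Y) := (upd z.1 p z.2, z.1 p).
have phiK : involutive phi.
  case=> w y; rewrite /phi /= ffunE eqxx; congr (_, _).
  by apply/ffunP => i; rewrite !ffunE; case: eqP => [->|].
transitivity (\sum_(z : {ffun I -> Y} * Y) weight z.1 * mu p z.2 * g z.1).
  rewrite -(pair_bigA _ (fun w y => weight w * mu p y * g w)) /=.
  apply: eq_bigr => w _; rewrite -[LHS]mulr1 -(hmu p).2 mulr_sumr.
  by apply: eq_bigr => y _; ring.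
rewrite (reindex_inj (inv_inj phiK)) /=.
rewrite -(pair_bigA _ (fun w y => weight (upd w p y) * mu p (w p) * g (upd w p y))) /=.
apply: eq_bigr => w _; rewrite mulr_sumr; apply: eq_bigr => y _.
by rewrite weight_upd; ring.
Qed.

(** A bound conditional on all coordinates other than [p] is a bound on the whole. *)
Lemma resample_le (g : {ffun I -> Y} -> R) p e :
  (forall w, \sum_y mu p y * g (upd w p y) <= e) -> \sum_w weight w * g w <= e.
Proof. by move=> h; rewrite (resample g p); exact: sum_weight_le. Qed.
End ProductWeight.

(** * Bernstein tails for empirical means, as finite sums *)

Section Bernstein.
Variables (R : realType) (S : finType).

(** [exp x] is at most [(1 - x/2)^(-2)], which leaves a polynomial inequality whose quadratic factor
    is positive for [x <= 1/2]. *)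
Lemma expR_le_quad (x : R) : x <= 2^-1 -> expR x <= 1 + x + 2 * x ^+ 2.
Proof.
move=> hx; have h1 : 0 < 1 - x / 2 by lra.
have h2 : 1 - x / 2 <= expR (- (x / 2)) by have := expR_ge1Dx (- (x / 2)); lra.
have h3 : expR (x / 2) <= (1 - x / 2)^-1.
  by rewrite -[leLHS]invrK -expRN lef_pV2 ?posrE ?expR_gt0.
have -> : expR x = expR (x / 2) ^+ 2 by rewrite expr2 -expRD; congr expR; field.
apply: (@le_trans _ _ ((1 - x / 2)^-1 ^+ 2)).
  by rewrite lerXn2r ?nnegrE ?expR_ge0 // invr_ge0 ltW.
rewrite exprVn -div1r ler_pdivrMr ?exprn_gt0 // -subr_ge0.
have -> : (1 + x + 2 * x ^+ 2) * (1 - x / 2) ^+ 2 - 1 =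
    x ^+ 2 * (5 / 4 - 7 / 4 * x + x ^+ 2 / 2) by field.
by rewrite mulr_ge0 ?sqr_ge0 //; have := sqr_ge0 x; lra.
Qed.

Lemma mgf_le (p f : S -> R) lam : is_pmf p ->
  (forall y, lam * (f y - mean p f) <= 2^-1) ->
  mean p (fun y => expR (lam * (f y - mean p f))) <= expR (2 * lam ^+ 2 * var p f).
Proof.
move=> hp hf; apply: (@le_trans _ _ (1 + 2 * lam ^+ 2 * var p f)); last exact: expR_ge1Dx.
have -> : 1 + 2 * lam ^+ 2 * var p f =
  mean p (fun y => 1 + lam * (f y - mean p f) + 2 * (lam * (f y - mean p f)) ^+ 2).
  have -> : mean p (fun y => 1 + lam * (f y - mean p f) + 2 * (lam * (f y - mean p f)) ^+ 2)
    = mean p (fun y => 1 + lam * (f y - mean p f) + (2 * lam ^+ 2) * (f y - mean p f) ^+ 2).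
    by apply: eq_mean => y; ring.
  rewrite !meanD mean_cst // !meanZ meanB mean_cst // subrr mulr0 addr0.
  by rewrite /var /mean.
by apply: le_mean => // y; exact: expR_le_quad.
Qed.

(** The exponential Markov inequality with [lam] left free instead of optimised, which produces the
    linear form. The indicator is bounded by the exponential of an exponent that is nonnegative on
    the event. *)
Lemma chernoff (p f : S -> R) n lam L : is_pmf p -> 0 < lam -> (0 < n)%N ->
  (forall y, lam * (f y - mean p f) <= 2^-1) ->
  \sum_(w : {ffun 'I_n -> S}) (\prod_k p (w k)) *
    (2 * lam * var p f + L / (n%:R * lam) < (\sum_k f (w k)) / n%:R - mean p f)%R%:R
  <= expR (- L).
Proof.
move=> hp l0 n0 hf; have nR : 0 < n%:R :> R by rewrite ltr0n.
pose t := n%:R * (2 * lam ^+ 2 * var p f) + L.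
apply: (@le_trans _ _ (\sum_(w : {ffun 'I_n -> S})
    (\prod_k (p (w k) * expR (lam * (f (w k) - mean p f)))) * expR (- t))).
  apply: ler_sum => w _; rewrite big_split /= -[leRHS]mulrA ler_wpM2l //.
    by apply: prodr_ge0 => k _; exact: hp.1.
  rewrite -expR_sum -expRD; case: ltP => [h|_]; last exact: expR_ge0.
  apply: le_trans (expR_ge1Dx _); rewrite lerDl.
  rewrite -mulr_sumr sumrB sumr_const card_ord.
  move: h; rewrite -(ltr_pM2l (mulr_gt0 nR l0)) => /ltW.
  rewrite -subr_ge0; congr (0 <= _); rewrite /t -mulr_natl; field.
  by rewrite !lt0r_neq0.
rewrite -mulr_suml -(bigA_distr_bigA (fun k y => p y * expR (lam * (f y - mean p f)))) /=.
rewrite prodr_const card_ord.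
apply: (@le_trans _ _ (expR (2 * lam ^+ 2 * var p f) ^+ n * expR (- t))).
  rewrite ler_wpM2r ?expR_ge0 // lerXn2r ?nnegrE ?expR_ge0 //; last exact: mgf_le.
  by apply: sumr_ge0 => y _; rewrite mulr_ge0 ?expR_ge0 //; exact: hp.1.
by rewrite -expRM_natl -expRD ler_expR /t; lra.
Qed.

Lemma bernstein_tail (p f : S -> R) n lam L : is_pmf p -> 0 < lam -> (0 < n)%N ->
  (forall y, `|lam * (f y - mean p f)| <= 2^-1) ->
  \sum_(w : {ffun 'I_n -> S}) (\prod_k p (w k)) *
    (2 * lam * var p f + L / (n%:R * lam) < `|(\sum_k f (w k)) / n%:R - mean p f|)%R%:R
  <= 2 * expR (- L).
Proof.
move=> hp l0 n0 hf.
have hf1 y : lam * (f y - mean p f) <= 2^-1 by exact: le_trans (ler_norm _) (hf y).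
have hf2 y : lam * (- f y - mean p (fun z => - f z)) <= 2^-1.
  have -> : lam * (- f y - mean p (fun z => - f z)) = - (lam * (f y - mean p f)).
    by rewrite meanN; ring.
  by apply: le_trans (ler_norm _) _; rewrite normrN.
have h1 := chernoff L hp l0 n0 hf1; have h2 := chernoff L hp l0 n0 hf2.
have -> : 2 * expR (- L) = expR (- L) + expR (- L) by ring.
apply: le_trans (lerD h1 h2).
rewrite -big_split /=; apply: ler_sum => w _; rewrite -mulrDr ler_wpM2l //.
  by apply: prodr_ge0 => k _; exact: hp.1.
have -> : var p (fun y => - f y) = var p f.
  by rewrite /var meanN; apply: eq_bigr => y _; ring.
rewrite meanN sumrN mulNr -opprD.
set b := 2 * _ * _ + _; set x := _ / _ - _.
have -> : - ((\sum_k f (w k)) / n%:R - mean p f) = - x by [].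
case: (ltP b `|x|) => [h|_]; last by rewrite addr_ge0 ?ler0n.
have [x0|x0] := leP 0 x.
  by rewrite ger0_norm // in h; rewrite h lerDl ler0n.
by rewrite ltr0_norm // in h; rewrite h lerDr ler0n.
Qed.
End Bernstein.

(** * Discretization of the data law *)

Section Cells.
Context {R : realType} {S A : finType} {d : measure_display} {T : measurableType d}.
Variables (Pr : probability T R) (P : S -> A -> S -> R) (n : nat) (xi : R).
Variables (X : T -> S -> A -> 'I_n -> S) (Delta : T -> S -> A -> R).
Hypothesis hlaw : data_law Pr P xi X Delta.
Hypothesis xi0 : 0 < xi.

Definition sample_pmf (p : S * A) (y : {ffun 'I_n -> S}) : R := \prod_k P p.1 p.2 (y k).
Definition sample_eq (w : {ffun S * A -> {ffun 'I_n -> S}}) t :=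
  forall s a k, X t s a k = w (s, a) k.

(** [data_law] only provides lower orthants in [Delta]. Lower bounds are added one coordinate at a
    time: the box is the difference of two boxes whose upper ends at [p] are [b p] and [a p]. *)
Lemma box_law (w : {ffun S * A -> {ffun 'I_n -> S}}) (a : S * A -> R)
  (l : seq (S * A)) : uniq l -> forall b : S * A -> R, (forall q, q \in l -> a q <= b q) ->
  let E := [set t | sample_eq w t /\ (forall q, Delta t q.1 q.2 <= b q) /\
                    (forall q, q \in l -> a q < Delta t q.1 q.2)] in
  measurable E /\
  Pr E = (weight sample_pmf w *
    \prod_q (if q \in l then unif_cdf xi (b q) - unif_cdf xi (a q) else unif_cdf xi (b q)))%:E.
Proof.
elim: l => [|p l IH] /=.
  move=> _ b _; have [h1 h2] := hlaw (fun s a k => w (s, a) k) (fun s a => b (s, a)).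
  set E' := [set t | _] in h1 h2; set E := [set t | _].
  have -> : E = E'.
    apply/seteqP; split => t /= => [[h3 [h4 _]]|[h3 h4]]; first by split => // s a'; exact: (h4 (s, a')).
    by split => //; split => // -[s a']; exact: h4.
  split => //; rewrite h2; congr (_%:E).
  rewrite /weight /sample_pmf; congr (_ * _).
    rewrite pair_bigA /=; apply: eq_bigr => -[s a'] _ /=; by [].
  by rewrite pair_bigA /=; apply: eq_bigr => -[s a'] _.
move=> /andP[pl ul] b hab.
pose b' q := if q == p then a p else b q.
have hb q : q \in l -> a q <= b q by move=> ql; apply: hab; rewrite inE ql orbT.
have hb' q : q \in l -> a q <= b' q.
  by move=> ql; rewrite /b' (negbTE (memPn pl q ql)); exact: hb.
have [m1 e1] := IH ul b hb; have [m2 e2] := IH ul b' hb'.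
set E1 := [set t | _] in m1 e1; set E2 := [set t | _] in m2 e2; set E := [set t | _].
have eE : E = E1 `\` E2.
  apply/seteqP; split => t /=.
    move=> [h1 [h2 h3]]; split; first by split => //; split => // q ql; apply: h3; rewrite inE ql orbT.
    move=> [_ [h4 _]]; have := h4 p; rewrite /b' eqxx leNgt => /negP; apply.
    by apply: h3; rewrite inE eqxx.
  move=> [[h1 [h2 h3]] h4]; split => //; split => // q; rewrite inE => /orP[/eqP ->|]; last exact: h3.
  rewrite ltNge; apply/negP => h5; apply: h4; split => //; split => // r.
  by rewrite /b'; case: eqP => [->|_].
have sub : E2 `<=` E1.
  move=> t [h1 [h2 h3]]; split => //; split => // q.
  apply: (le_trans (h2 q)); rewrite /b'; case: eqP => // ->.
  by apply: hab; rewrite inE eqxx.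
split; first by rewrite eE; exact: measurableD.
have eD : Pr (E1 `\` E2) = (Pr E1 - Pr E2)%E.
  rewrite measureD //; last by rewrite ltey_eq fin_num_measure.
  by rewrite (setIidr sub).
rewrite eE eD e1 e2 -EFinB -mulrBr; congr (_ * _)%:E.
rewrite (bigD1 p) //= [X in _ - X](bigD1 p) //= [RHS](bigD1 p) //=.
rewrite (negbTE pl) inE eqxx /= {1}/b' eqxx.
set r1 := \prod_(i | _) _; set r2 := \prod_(i | _) _; set r3 := \prod_(i | _) _.
have -> : r2 = r1 by apply: eq_bigr => q /negbTE qp; rewrite /b' qp.
have -> : r3 = r1 by apply: eq_bigr => q /negbTE qp; rewrite inE qp.
by rewrite mulrBl.
Qed.

Variable K : nat.
Hypothesis K0 : (0 < K)%N.

(** Open on the left, as differences of lower orthants are. Perturbations outside []0, xi]] belong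
    to no cell; the cells still carry total mass 1. *)
Definition in_cell (c : {ffun S * A -> 'I_K}) t := forall s a,
  xi * (c (s, a))%:R / K%:R < Delta t s a <= xi * (c (s, a)).+1%:R / K%:R.
Definition cell_pmf (p : S * A) (k : 'I_K) : R := K%:R^-1.
Definition cell (z : {ffun S * A -> {ffun 'I_n -> S}} * {ffun S * A -> 'I_K}) :=
  [set t | sample_eq z.1 t /\ in_cell z.2 t].

Lemma unif_cdf_grid k : (k <= K)%N -> unif_cdf xi (xi * k%:R / K%:R) = k%:R / K%:R.
Proof.
move=> kK; have KR : 0 < K%:R :> R by rewrite ltr0n.
rewrite /unif_cdf mulrC mulrA mulrA mulVf ?lt0r_neq0 // mul1r.
have h0 : 0 <= k%:R / K%:R :> R by rewrite divr_ge0 ?ler0n.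
have h1 : k%:R / K%:R <= 1 :> R by rewrite ler_pdivrMr // mul1r ler_nat.
by rewrite max_r // min_r.
Qed.

Lemma cell_law z : measurable (cell z) /\
  Pr (cell z) = (weight sample_pmf z.1 * weight cell_pmf z.2)%:E.
Proof.
case: z => w c; pose a (q : S * A) := xi * (c q)%:R / K%:R.
pose b (q : S * A) := xi * (c q).+1%:R / K%:R.
have KR : 0 < K%:R :> R by rewrite ltr0n.
have hab q : q \in enum {: S * A} -> a q <= b q.
  by move=> _; rewrite ler_pM2r ?invr_gt0 // ler_pM2l // ler_nat.
have [] := @box_law w a (enum {: S * A}) (enum_uniq _) b hab.
set E := [set t | _].
have -> : cell (w, c) = E.
  apply/seteqP; split => t /=.
    move=> [h1 h2]; split => //; split => [[s x]|[s x] _]; by have /andP[] := h2 s x.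
  move=> [h1 [h2 h3]]; split => // s x; apply/andP; split; last exact: (h2 (s, x)).
  by apply: (h3 (s, x)); rewrite mem_enum.
move=> m e; split => //; rewrite e; congr (_ * _)%:E.
apply: eq_bigr => q _; rewrite mem_enum inE /= /a /b !unif_cdf_grid //; last exact: ltnW.
by rewrite /cell_pmf -mulrBl -natrB // subSnn mul1r.
Qed.

Lemma cell_disjoint z z' t : cell z t -> cell z' t -> z = z'.
Proof.
have KR : 0 < K%:R :> R by rewrite ltr0n.
case: z z' => [w c] [w' c'] /= [h1 h2] [h3 h4]; congr (_, _).
  by apply/ffunP => -[s a]; apply/ffunP => k; rewrite -h1 -h3.
have le u v s a : in_cell u t -> in_cell v t -> (u (s, a) <= v (s, a))%N.
  move=> /(_ s a)/andP[hu _] /(_ s a)/andP[_ hv].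
  have := lt_le_trans hu hv; rewrite ltr_pM2r ?invr_gt0 // ltr_pM2l // ltr_nat.
  by rewrite ltnS.
by apply/ffunP => -[s a]; apply/val_inj/eqP; rewrite eqn_leq !le.
Qed.

Hypothesis hP : is_kernel P.

Lemma sample_pmfP p : is_pmf (sample_pmf p).
Proof.
split => [y|]; first by apply: prodr_ge0 => k _; exact: (hP _ _).1.
rewrite /sample_pmf -(bigA_distr_bigA (fun k s => P p.1 p.2 s)) big1 // => k _.
exact: (hP _ _).2.
Qed.

Lemma cell_pmfP p : is_pmf (cell_pmf p).
Proof.
split => [k|]; first by rewrite invr_ge0 ler0n.
by rewrite /cell_pmf sumr_const card_ord -[_ *+ _]mulr_natr mulVf // pnatr_eq0 -lt0n.
Qed.

(** [E] is the union of the cells on which [G] holds. The finitely many cells are disjoint and have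
    total mass 1, so the finite sum in the hypothesis bounds the mass that is missing from [E]. *)
Lemma cells_event (G : {ffun S * A -> {ffun 'I_n -> S}} -> {ffun S * A -> 'I_K} -> bool) delta :
  \sum_w weight sample_pmf w * \sum_c weight cell_pmf c * (~~ G w c)%:R <= delta ->
  exists E : set T, measurable E /\ ((1 - delta)%:E <= Pr E)%E /\
    forall t, E t -> exists w c, G w c /\ sample_eq w t /\ in_cell c t.
Proof.
move=> hd; pose F z := cell z.
pose good := [seq z <- enum {: {ffun S * A -> {ffun 'I_n -> S}} * {ffun S * A -> 'I_K}} | G z.1 z.2].
have hF (l : seq _) : uniq l -> measurable (\big[setU/set0]_(z <- l) F z) /\
  Pr (\big[setU/set0]_(z <- l) F z) =
    (\sum_(z <- l) weight sample_pmf z.1 * weight cell_pmf z.2)%:E.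
  elim: l => [|z l IH] /=; first by rewrite !big_nil measure0.
  move=> /andP[zl ul]; have [m e] := IH ul; have [mz ez] := cell_law z.
  rewrite !big_cons; split; first exact: measurableU.
  have dis : F z `&` \big[setU/set0]_(j <- l) F j = set0.
    apply/seteqP; split => // t [/= h1]; rewrite -bigcup_seq => -[z' /= z'l h2].
    by move: zl; rewrite (cell_disjoint h1 h2) z'l.
  have eU : Pr (F z `|` \big[setU/set0]_(j <- l) F j) =
      (Pr (F z) + Pr (\big[setU/set0]_(j <- l) F j))%E by rewrite measureU.
  by rewrite eU e ez.
have [m e] := hF good (filter_uniq _ (enum_uniq _)).
exists (\big[setU/set0]_(z <- good) F z); split => //; split.
  rewrite e lee_fin.
  have : \sum_(z : {ffun S * A -> {ffun 'I_n -> S}} * {ffun S * A -> 'I_K})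
      weight sample_pmf z.1 * weight cell_pmf z.2 = 1.
    rewrite -(pair_bigA _ (fun w c => weight sample_pmf w * weight cell_pmf c)) /=.
    rewrite (eq_bigr (fun w => weight sample_pmf w)) => [|w _].
      exact: sum_weight sample_pmfP.
    by rewrite -mulr_sumr (sum_weight cell_pmfP) mulr1.
  rewrite (bigID (fun z => G z.1 z.2)) /= => h1.
  rewrite /good big_filter big_enum_cond /=.
  suff : \sum_(z | ~~ G z.1 z.2) weight sample_pmf z.1 * weight cell_pmf z.2 <= delta by lra.
  apply: le_trans hd; rewrite big_mkcond /=.
  under [leRHS]eq_bigr do rewrite mulr_sumr.
  rewrite (pair_bigA _ (fun w c => weight sample_pmf w * (weight cell_pmf c * (~~ G w c)%:R))) /=.
  by apply: ler_sum => -[w c] _ /=; case: (G w c); rewrite /= ?mulr0 // mulr1.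
move=> t; rewrite -bigcup_seq => -[[w c]]; rewrite /= mem_filter => /andP[/= hG _] [h1 h2].
by exists w, c.
Qed.
End Cells.

(** * Leave-one-out optimal values *)

Section OptimalValue.
Variables (R : realType) (S A : finType).
Implicit Types (Q : S -> A -> S -> R) (r : S -> A -> R) (pi : S -> A) (V : S -> R).

Definition qval g Q r V s a : R := r s a + g * \sum_y Q s a y * V y.

Lemma is_opt_mono g Q r r' V V' : subkernel Q -> 0 <= g < 1 ->
  is_opt g Q r V -> is_opt g Q r' V' -> (forall s a, r s a <= r' s a) ->
  forall s, V s <= V' s.
Proof.
move=> hQ hg h1 h2 hr s; rewrite -subr_le0.
have /choice[pi hpi] : forall s, exists a, V s = r s a + g * \sum_y Q s a y * V y.
  by move=> x; have [] := h1 x.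
apply: (@max_principle0 _ _ (Ppi Q pi) g (fun s => V s - V' s)) => //.
  exact: subkernel_Ppi.
move=> x; rewrite appB {1}hpi -/(app (Ppi Q pi) V x).
by have := (h2 x).1 (pi x); rewrite -/(app (Ppi Q pi) V' x); have := hr x (pi x); lra.
Qed.

Lemma qval_le g Q r V V' e s a : is_kernel Q -> 0 <= g < 1 -> 0 <= e ->
  (forall s, V' s <= V s + e) -> qval g Q r V' s a <= qval g Q r V s a + g * e.
Proof.
move=> hQ /andP[g0 g1] e0 h; rewrite /qval -addrA lerD2l -mulrDr ler_wpM2l //.
rewrite -[e]mul1r -(hQ s a).2 mulr_suml -big_split; apply: ler_sum => y _ /=.
by rewrite -mulrDr ler_wpM2l ?(hQ s a).1.
Qed.

(* The advantage of (s, a) grows at unit rate with its reward, so near ties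
   confine that reward to a short window. *)
Lemma near_tie_width g Q r r' V V' s a a' theta om : is_kernel Q -> 0 <= g < 1 ->
  is_opt g Q r V -> is_opt g Q r' V' -> 0 <= theta -> 0 <= om -> a' != a ->
  (forall x b, r' x b = if (x == s) && (b == a) then r x b + theta else r x b) ->
  V s - om <= qval g Q r V s a -> V' s - om <= qval g Q r' V' s a' ->
  theta <= om + om / (1 - g).
Proof.
move=> hQ hg hV hV' t0 o0 aa hr h1 h2; have hW := is_kernelW hQ.
have /andP[g0 g1] := hg; have g1' : 0 < 1 - g by rewrite subr_gt0.
have mono x : V x <= V' x.
  apply: (is_opt_mono hW hg hV hV') => y b; rewrite hr.
  by case: ifP => _ //; rewrite lerDl.
(* [V' s - V s] is at least [theta - om], as [a] was within [om] of optimal before gaining [theta].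
   It is at most [om / (1 - g)], as the rival [a'], whose reward is unchanged, is within [om] of
   optimal afterwards. *)
have h3 : theta - om <= V' s - V s.
  have := (hV' s).1 a; rewrite -/(qval g Q r' V' s a) => h4.
  have : qval g Q r V s a + theta <= qval g Q r' V' s a.
    rewrite /qval hr !eqxx /=; have : \sum_y Q s a y * V y <= \sum_y Q s a y * V' y.
      by apply: ler_sum => y _; rewrite ler_wpM2l ?(hQ s a).1.
    by move=> /(ler_wpM2l g0); lra.
  lra.
suff : V' s - V s <= om / (1 - g) by lra.
have [x _ hx] := @Order.TotalTheory.arg_maxP _ _ _ s xpredT (fun x => V' x - V x) isT.
set m := V' x - V x in hx.
have hm y : V' y <= V y + m.
  by have : V' y - V y <= m by [exact: hx]; lra.
have m0 : 0 <= m by rewrite subr_ge0 mono.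
have omg : 0 <= om / (1 - g) by rewrite divr_ge0 // ltW.
have dm b y : r' y b = r y b -> qval g Q r' V' y b <= V y + g * m.
  move=> e; apply: le_trans (qval_le r' y b hQ hg m0 hm) _; rewrite lerD2r /qval e.
  exact: (hV y).1.
have [xs|xs] := eqVneq x s.
  rewrite -{1}xs -[X in _ - X]/(V s) -xs -/m ler_pdivlMr //.
  have := dm a' s; rewrite hr eqxx (negbTE aa) /= => /(_ erefl).
  by rewrite /m xs in h2 *; lra.
have [b hb] := (hV' x).2.
have := dm b x; rewrite hr (negbTE xs) /= => /(_ erefl); rewrite /qval -hb => h4.
have : m * (1 - g) <= 0 by rewrite /m in h4 *; lra.
rewrite pmulr_lle0 // => h5.
by apply: le_trans omg; have := hm s; lra.
Qed.

(** A choice that depends on [g], [Q] and [r] alone: equal leave-one-out models get literally equal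
    values, and likewise equal [greedy] policies, which [probe_upd] exploits. *)
Definition optval g Q r : S -> R := xget (fun=> 0) [set V | is_opt g Q r V].

Lemma optvalP g Q r (a0 : A) : subkernel Q -> 0 <= g < 1 -> is_opt g Q r (optval g Q r).
Proof. by move=> hQ hg; have [V hV] := is_opt_exists r a0 hQ hg; exact: (xgetPex _ (ex_intro _ V hV)). Qed.

Definition greedy g Q r (pi0 : S -> A) : S -> A := fun s =>
  odflt (pi0 s) [pick a | optval g Q r s <= qval g Q r (optval g Q r) s a].

Lemma greedyP g Q r pi0 s : subkernel Q -> 0 <= g < 1 ->
  optval g Q r s <= qval g Q r (optval g Q r) s (greedy g Q r pi0 s).
Proof.
move=> hQ hg; rewrite /greedy; case: pickP => //= h.
have [_ [a ha]] := optvalP r (pi0 s) hQ hg s.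
by have := h a; rewrite /qval -ha lexx.
Qed.

(* Leaving the pair p out: it terminates with payoff q. *)
Definition loo_kernel Q (p : S * A) : S -> A -> S -> R :=
  fun s a y => if (s, a) == p then 0 else Q s a y.
Definition loo_reward r (p : S * A) q : S -> A -> R :=
  fun s a => if (s, a) == p then q else r s a.

Lemma loo_subkernel Q p : is_kernel Q -> subkernel (loo_kernel Q p).
Proof.
move=> hQ s a; rewrite /loo_kernel; split => [y|]; case: eqP => // _.
- exact: (hQ s a).1.
- by rewrite big1 ?ler01.
- by rewrite (hQ s a).2.
Qed.

Lemma loo_qval g Q r p q V s a : (s, a) != p ->
  qval g (loo_kernel Q p) (loo_reward r p q) V s a = qval g Q r V s a.
Proof. by move=> /negbTE h; rewrite /qval /loo_kernel /loo_reward h. Qed.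

Lemma loo_qval_at g Q r p q V :
  qval g (loo_kernel Q p) (loo_reward r p q) V p.1 p.2 = q.
Proof.
rewrite /qval /loo_reward /loo_kernel -surjective_pairing eqxx.
by rewrite big1 ?mulr0 ?addr0 // => y _; rewrite mul0r.
Qed.

(** Paying exactly the Q-value of [p] makes termination at [p] equivalent to continuing; this is the
    payoff that the grid approximates. *)
Lemma loo_is_opt g Q r p V : is_opt g Q r V ->
  is_opt g (loo_kernel Q p) (loo_reward r p (qval g Q r V p.1 p.2)) V.
Proof.
move=> hV s.
have e a : qval g (loo_kernel Q p) (loo_reward r p (qval g Q r V p.1 p.2)) V s a =
    qval g Q r V s a.
  have [e|/loo_qval ->//] := eqVneq (s, a) p.
  by have := loo_qval_at g Q r p (qval g Q r V p.1 p.2) V; rewrite -e.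
have [h1 [b hb]] := hV s; split => [a|].
  by have := e a; rewrite {1}/qval => ->; exact: h1.
by exists b; have := e b; rewrite {1}/qval => ->.
Qed.

Lemma loo_optval_close g Q r p q V e : is_kernel Q -> 0 <= g < 1 -> is_opt g Q r V ->
  `|q - qval g Q r V p.1 p.2| <= e ->
  forall s, `|optval g (loo_kernel Q p) (loo_reward r p q) s - V s| <= e / (1 - g).
Proof.
move=> hQ hg hV he; have e0 : 0 <= e by exact: le_trans he.
have hL := loo_subkernel p hQ.
apply: (is_opt_lip hL hg e0 (optvalP _ p.2 hL hg) (loo_is_opt p hV)).
by move=> s a; rewrite /loo_reward; case: eqP => // _; rewrite subrr normr0.
Qed.

(** One error [e / (1 - g)] comes from the value at [s], the other from the Q-value of the chosen
    action. In the absence of near ties this pins the action down. *)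
Lemma loo_greedy_near g Q r p q V e pi0 s : is_kernel Q -> 0 <= g < 1 -> is_opt g Q r V ->
  `|q - qval g Q r V p.1 p.2| <= e ->
  V s - 2 * (e / (1 - g)) <=
    qval g Q r V s (greedy g (loo_kernel Q p) (loo_reward r p q) pi0 s).
Proof.
move=> hQ hg hV he; have hL := loo_subkernel p hQ.
have /andP[g0 g1] := hg; have g1' : 0 < 1 - g by rewrite subr_gt0.
have e0 : 0 <= e by exact: le_trans he.
have hc := loo_optval_close hQ hg hV he.
have := greedyP (loo_reward r p q) pi0 s hL hg.
set V1 := optval _ _ _ in hc *; set a := greedy _ _ _ _ _ => h1.
have ee : e <= e / (1 - g) by rewrite ler_pdivlMr // ler_piMr //; lra.
set E := e / (1 - g) in hc ee *; have E0 : 0 <= E by exact: le_trans ee.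
have h2 := hc s; rewrite ler_norml in h2; have /andP[h3 h4] := h2.
suff : qval g (loo_kernel Q p) (loo_reward r p q) V1 s a <= qval g Q r V s a + E by lra.
have [ep|/loo_qval ->] := eqVneq (s, a) p.
  have := loo_qval_at g Q r p q V1; rewrite -ep /= => ->.
  move: he; rewrite -ep /= ler_norml => /andP[]; lra.
apply: le_trans (qval_le (V := V) (e := E) r s a hQ hg E0 _) _.
  by move=> y; have := hc y; rewrite ler_norml => /andP[]; lra.
by rewrite lerD2l ler_piMl // ltW.
Qed.

(** Carries the optimality of [pihat] from the actual perturbed reward to the reward rounded to a
    cell corner, for which near ties are excluded. *)
Lemma perturbed_near g Q r r' V V' e s a : is_kernel Q -> 0 <= g < 1 ->
  is_opt g Q r V -> is_opt g Q r' V' -> (forall s a, `|r' s a - r s a| <= e) ->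
  V' s = qval g Q r' V' s a -> V s - 2 * (e / (1 - g)) <= qval g Q r V s a.
Proof.
move=> hQ hg hV hV' he ha; have hW := is_kernelW hQ.
have /andP[g0 g1] := hg; have g1' : 0 < 1 - g by rewrite subr_gt0.
have e0 : 0 <= e by exact: le_trans (he s a).
have hc := is_opt_lip hW hg e0 hV' hV he.
set E := e / (1 - g) in hc *.
have E0 : 0 <= E by rewrite divr_ge0 // ltW.
have h2 := hc s; rewrite ler_norml in h2; have /andP[h3 h4] := h2.
have h5 : qval g Q r' V' s a <= qval g Q r' V s a + g * E.
  by apply: qval_le => // y; have := hc y; rewrite ler_norml => /andP[]; lra.
have h6 : qval g Q r' V s a <= qval g Q r V s a + e.
  by rewrite /qval; have := he s a; rewrite ler_norml => /andP[]; lra.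
have : E = e + g * E by rewrite /E; field; rewrite lt0r_neq0.
lra.
Qed.
End OptimalValue.

(** * The good event *)

Section GoodEvent.
Variables (R : realType) (S A : finType) (n K J : nat).
Variables (P : S -> A -> S -> R) (r : S -> A -> R) (s0 : S) (pistar : S -> A).
Variables (g xi om L : R).
Hypothesis hP : is_kernel P.
Hypothesis hg : 0 <= g < 1.
Hypothesis n0 : (0 < n)%N.
Hypothesis K0 : (0 < K)%N.
Hypothesis L0 : 0 < L.
Hypothesis xi0 : 0 < xi.
Hypothesis om0 : 0 <= om.

Notation samples := {ffun S * A -> {ffun 'I_n -> S}}.
Notation cells := {ffun S * A -> 'I_K}.

Notation smu := (@sample_pmf R S A P n).
Notation cmu := (@cell_pmf R S A K).

Definition emp (w : samples) : S -> A -> S -> R :=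
  emp_kernel R (fun s a k => w (s, a) k).
(** The lower corner stands in for the unknown perturbation, so that the model depends on finite
    data only. *)
Definition corner (c : cells) : S -> A -> R :=
  fun s a => r s a + xi * (c (s, a))%:R / K%:R.

Lemma emp_mean w s a f : mean (emp w s a) f = (\sum_k f (w (s, a) k)) / n%:R.
Proof.
rewrite /mean /emp /emp_kernel; under eq_bigr do rewrite mulrAC mulr_suml.
rewrite -mulr_suml exchange_big /=; congr (_ / _); apply: eq_bigr => k _.
rewrite (bigD1 (w (s, a) k)) //= eqxx mul1r big1 ?addr0 // => y.
by rewrite eq_sym => /negbTE ->; rewrite mul0r.
Qed.

Lemma emp_is_kernel w : is_kernel (emp w).
Proof.
move=> s a; split => [y|]; first by rewrite divr_ge0 ?sumr_ge0.
have := emp_mean w s a (fun=> 1); rewrite /mean; under eq_bigr do rewrite mulr1.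
by move=> ->; rewrite sumr_const card_ord divff // pnatr_eq0 -lt0n.
Qed.

(** A candidate within 2 of a value in sup norm has a span within 4 of it, so the margin 5 keeps the
    padded span of the candidate at least the span of the value plus 1. *)
Definition padded_spn (f : S -> R) := spn f + 5.
(** The [lam] that balances [lam * padded_spn f] against [L / (n lam)]; see [bern_scaleE]. *)
Definition bern_scale (f : S -> R) := Num.sqrt (L / (n%:R * padded_spn f)).
Definition fmin (f : S -> R) := f [arg min_(s < s0) f s]%O.

Lemma fmin_le f s : fmin f <= f s.
Proof. by rewrite /fmin; case: arg_minP => // i _; apply. Qed.

Lemma fmin_spn f s : 0 <= f s - fmin f <= spn f.
Proof. by rewrite subr_ge0 fmin_le spn_ge. Qed.

Lemma padded_spn_gt0 f : 0 < padded_spn f.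
Proof. by rewrite /padded_spn; have := spn_ge0 f; lra. Qed.

Lemma bern_scale_gt0 f : 0 < bern_scale f.
Proof. by rewrite sqrtr_gt0 divr_gt0 // mulr_gt0 ?ltr0n ?padded_spn_gt0. Qed.

Definition tail (p : S * A) (y : {ffun 'I_n -> S}) (f : S -> R) (l : R) : bool :=
  2 * l * var (P p.1 p.2) f + L / (n%:R * l)
    < `|(\sum_k f (y k)) / n%:R - mean (P p.1 p.2) f|.

(* The squares control the change of variance between the two models.  The
   scale depends on f itself, which is why f must not see the samples y. *)
Definition bad_vec p y f : bool :=
  (16 * bern_scale f * padded_spn f <= 1) &&
  (tail p y (fun s => f s - fmin f) (bern_scale f) ||
   tail p y (fun s => (f s - fmin f) ^+ 2) (bern_scale f / padded_spn f)).

Lemma bad_vec_prob p f :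
  \sum_y sample_pmf P p y * (bad_vec p y f)%:R <= 4 * expR (- L).
Proof.
have e0 := expR_gt0 (- L).
rewrite /bad_vec; case: (boolP (16 * bern_scale f * padded_spn f <= 1)) => /= hc; last first.
  by rewrite big1 ?mulr_ge0 ?expR_ge0 // => y _; rewrite mulr0.
have hp := kernel_pmf p.1 p.2 hP.
have l0 := bern_scale_gt0 f; have t0 := padded_spn_gt0 f.
have dev (h : S -> R) b l : 0 <= l -> (forall y, 0 <= h y <= b) -> l * b <= 2^-1 ->
    forall y, `|l * (h y - mean (P p.1 p.2) h)| <= 2^-1.
  move=> ll hb lb y; apply: le_trans lb; rewrite normrM (ger0_norm ll) ler_wpM2l //.
  have m0 : 0 <= mean (P p.1 p.2) h.
    by rewrite -(mean_cst 0 hp) le_mean // => z; have /andP[] := hb z.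
  have mb : mean (P p.1 p.2) h <= b.
    by rewrite -[leRHS](mean_cst b hp) le_mean // => z; have /andP[] := hb z.
  by have /andP[] := hb y; rewrite ler_norml => *; apply/andP; split; lra.
have W0 y : 0 <= f y - fmin f <= padded_spn f.
  by have /andP[-> h] := fmin_spn f y; rewrite (le_trans h) // /padded_spn; lra.
have t1 := @bernstein_tail _ _ (P p.1 p.2) (fun s => f s - fmin f) n (bern_scale f) L hp l0 n0
  (dev _ (padded_spn f) _ (ltW l0) W0 (ltac:(lra))).
have t2 := @bernstein_tail _ _ (P p.1 p.2) (fun s => (f s - fmin f) ^+ 2) n (bern_scale f / padded_spn f) L
  hp (divr_gt0 l0 t0) n0.
have {}t2 := t2 (dev _ (padded_spn f ^+ 2) _ (ltW (divr_gt0 l0 t0)) _ _).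
have -> : 4 * expR (- L) = 2 * expR (- L) + 2 * expR (- L) by ring.
apply: le_trans (lerD t1 (t2 _ _)).
- rewrite -big_split /=; apply: ler_sum => y _.
  rewrite -mulrDr /sample_pmf ler_wpM2l ?prodr_ge0 // => [k _|]; first exact: hp.1.
  rewrite -/(tail p y (fun s => f s - fmin f) (bern_scale f)).
  rewrite -/(tail p y (fun s => (f s - fmin f) ^+ 2) (bern_scale f / padded_spn f)).
  by case: (tail _ _ _ _); case: (tail _ _ _ _); rewrite /= ?addr0 ?add0r // lerDl.
- move=> y; have /andP[h1 h2] := W0 y; rewrite sqr_ge0 /= lerXn2r ?nnegrE //; exact: ltW.
- have -> : bern_scale f / padded_spn f * padded_spn f ^+ 2 = bern_scale f * padded_spn f by field; exact: lt0r_neq0.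
  lra.
Qed.

Definition ovalue (w : samples) (c : cells) : S -> R := optval g (emp w) (corner c).

Definition near_opt w c s a : bool := ovalue w c s - om < qval g (emp w) (corner c) (ovalue w c) s a.

(** Near ties are charged to a pair taking part in them, so that only the cell of that pair has to
    be resampled. *)
Definition gap_bad p w c : bool :=
  near_opt w c p.1 p.2 && [exists a', (a' != p.2) && near_opt w c p.1 a'].

Lemma card_ord_spread (B : {set 'I_K}) (m : nat) :
  (forall k k', k \in B -> k' \in B -> (k' <= k + m)%N) -> (#|B| <= m.+1)%N.
Proof.
move=> hB; have [->|/finset.set0Pn[k0 k0B]] := eqVneq B finset.set0; first by rewrite cards0.
have [k kB hk] := arg_minnP (fun k : 'I_K => val k) k0B.
pose h (i : 'I_K) : 'I_m.+1 := inord (i - k).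
rewrite -(card_ord m.+1) -(card_in_imset (f := h)) ?max_card // => i j iB jB.
move=> /(congr1 val); rewrite /= !inordK ?ltnS ?leq_subLR ?hB // => e.
by apply/val_inj; rewrite /= -(subnK (hk i iB)) e subnK // hk.
Qed.

(** Fix the samples and all other cells. For bad cells [k < k'] of [p], action [p.2] is near-optimal
    at [k] and a rival at [k']; [near_tie_width] bounds the reward difference [xi (k' - k) / K], so
    the bad cells lie in a window of [m + 1]. *)
Lemma gap_bad_prob p w (m : nat) : K%:R * (om + om / (1 - g)) <= xi * m%:R ->
  \sum_c weight cmu c * (gap_bad p w c)%:R <= m.+1%:R / K%:R.
Proof.
move=> hm; have KR : 0 < K%:R :> R by rewrite ltr0n.
have hE := emp_is_kernel w; have hW := is_kernelW hE.
apply: (@resample_le _ _ _ cmu (@cell_pmfP R S A K K0) _ p) => c.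
pose B := [set k | gap_bad p w (upd c p k)]%SET.
rewrite (_ : \sum_k _ = #|B|%:R / K%:R); last first.
  rewrite /cell_pmf -mulr_sumr mulrC; congr (_ / _).
  by rewrite -sum1_card natr_sum [RHS]big_mkcond /=; apply: eq_bigr => k _; rewrite inE; case: gap_bad.
rewrite ler_pM2r ?invr_gt0 // ler_nat; apply: card_ord_spread => k k'; rewrite !inE.
move=> hk hk'; have [|kk'] := leqP k' k; first by move=> h; exact: leq_trans h (leq_addr _ _).
have /andP[h1 _] := hk; have /andP[_ /existsP[a' /andP[aa h2]]] := hk'.
pose theta := xi * (k' - k)%:R / K%:R.
have o c' := optvalP (corner c') p.2 hW hg.
have hth : theta <= om + om / (1 - g).
  apply: (near_tie_width hE hg (o (upd c p k)) (o (upd c p k')) _ om0 aa _ (ltW h1) (ltW h2)).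
    by rewrite /theta divr_ge0 ?mulr_ge0 ?ler0n // ltW.
  move=> x b; rewrite /corner !ffunE.
  have -> : ((x, b) == p) = (x == p.1) && (b == p.2) by rewrite [p in LHS]surjective_pairing.
  case: ifP => // _; rewrite -addrA; congr (_ + _).
  by rewrite /theta -mulrDl -mulrDr -natrD subnKC // ltnW.
have : (k' - k)%:R <= m%:R :> R.
  rewrite -(ler_pM2l xi0); apply: le_trans hm.
  have -> : xi * (k' - k)%:R = K%:R * theta by rewrite /theta; field; rewrite lt0r_neq0.
  by rewrite ler_pM2l.
by rewrite ler_nat leq_subLR.
Qed.

(** Corner rewards are at most 2 and the horizon is [n], so Q-values lie in [[0, 2 n]]. *)
Definition grid (j : 'I_J.+1) : R := 2 * n%:R * j%:R / J%:R.
Definition loo_value p w c j : S -> R :=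
  optval g (loo_kernel (emp w) p) (loo_reward (corner c) p (grid j)).
Definition loo_policy p w c j : S -> A :=
  greedy g (loo_kernel (emp w) p) (loo_reward (corner c) p (grid j)) pistar.

(* Candidates for the values of pistar and pihat; none of them depends on the
   samples at p, see [probe_upd]. *)
Definition probe p w c (i : option ('I_J.+1 * bool)) : S -> R :=
  match i with
  | None => disc_value g P r pistar
  | Some (j, true) => loo_value p w c j
  | Some (j, false) => disc_value g P r (loo_policy p w c j)
  end.

Lemma loo_emp_upd p w y : loo_kernel (emp (upd w p y)) p = loo_kernel (emp w) p.
Proof.
apply/funext => s; apply/funext => a; apply/funext => z; rewrite /loo_kernel.
by case: eqP => // /eqP/negbTE h; rewrite /emp /emp_kernel ffunE h.
Qed.

Lemma probe_upd p w y c i : probe p (upd w p y) c i = probe p w c i.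
Proof.
case: i => [[j b]|]; last by [].
by rewrite /probe /loo_value /loo_policy loo_emp_upd.
Qed.

Definition good w c : bool :=
  [forall p, ~~ gap_bad p w c && [forall i, ~~ bad_vec p (w p) (probe p w c i)]].

(** Union bound over pairs and candidates. Near ties are bounded for fixed samples by averaging over
    cells; Bernstein failures for fixed cells by averaging first over the samples at [p], on which
    the candidate does not depend. *)
Lemma good_prob (m : nat) : K%:R * (om + om / (1 - g)) <= xi * m%:R ->
  \sum_w weight smu w * \sum_c weight cmu c * (~~ good w c)%:R
  <= (#|S| * #|A|)%:R * (m.+1%:R / K%:R + (J.+1 * 2).+1%:R * (4 * expR (- L))).
Proof.
move=> hm.
have hs := @sample_pmfP R S A P n hP; have hc := @cell_pmfP R S A K K0.
pose E (G : samples -> cells -> R) := \sum_w weight smu w *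
  \sum_c weight cmu c * G w c.
have leE G H : (forall w c, G w c <= H w c) -> E G <= E H.
  move=> h; apply: ler_sum => w _; rewrite ler_wpM2l ?weight_ge0 //.
  by apply: ler_sum => c _; rewrite ler_wpM2l ?weight_ge0.
have sumE (I : finType) (G : I -> samples -> cells -> R) :
    E (fun w c => \sum_i G i w c) = \sum_i E (G i).
  rewrite /E exchange_big /=; apply: eq_bigr => w _; rewrite -mulr_sumr; congr (_ * _).
  by rewrite exchange_big /=; apply: eq_bigr => c _; rewrite mulr_sumr.
have addE G H : E (fun w c => G w c + H w c) = E G + E H.
  rewrite /E -big_split /=; apply: eq_bigr => w _; rewrite -mulrDr; congr (_ * _).
  by rewrite -big_split /=; apply: eq_bigr => c _; rewrite mulrDr.
apply: (@le_trans _ _ (E (fun w c => \sum_p ((gap_bad p w c)%:R +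
    \sum_i (bad_vec p (w p) (probe p w c i))%:R)))).
  apply: leE => w c.
  have nn p : 0 <= (gap_bad p w c)%:R + \sum_i (bad_vec p (w p) (probe p w c i))%:R :> R.
    by rewrite addr_ge0 ?sumr_ge0.
  case: (boolP (good w c)) => /= [_|]; first by rewrite sumr_ge0.
  rewrite negb_forall => /existsP[p]; rewrite (bigD1 p) //= => h.
  apply: (@le_trans _ _ ((gap_bad p w c)%:R + \sum_i (bad_vec p (w p) (probe p w c i))%:R)); last first.
    by rewrite lerDl sumr_ge0.
  move: h; rewrite negb_and !negbK => /orP[->|]; first by rewrite lerDl sumr_ge0.
  rewrite negb_forall => /existsP[i]; rewrite negbK => h.
  by rewrite (bigD1 i) //= h addrCA lerDl addr_ge0 ?sumr_ge0.
rewrite sumE; apply: (@le_trans _ _ (\sum_(p : S * A) (m.+1%:R / K%:R +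
    (J.+1 * 2).+1%:R * (4 * expR (- L))))); last first.
  by rewrite sumr_const -[X in X <= _]mulr_natl card_prod.
apply: ler_sum => p _; rewrite addE; apply: lerD.
  by apply: (sum_weight_le hs) => w; exact: gap_bad_prob.
rewrite sumE; apply: (@le_trans _ _ (\sum_(i : option ('I_J.+1 * bool)) 4 * expR (- L))); last first.
  by rewrite sumr_const -[X in X <= _]mulr_natl card_option card_prod card_ord card_bool.
apply: ler_sum => i _; rewrite /E.
under eq_bigr do rewrite mulr_sumr; rewrite exchange_big /=.
rewrite (eq_bigr (fun c => weight cmu c *
    \sum_w weight smu w * (bad_vec p (w p) (probe p w c i))%:R)); last first.
  by move=> c _; rewrite mulr_sumr; apply: eq_bigr => w _; rewrite mulrCA.
apply: (sum_weight_le hc) => c.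
apply: (resample_le hs (p := p)) => w; apply: le_trans (bad_vec_prob p (probe p w c i)).
by apply: ler_sum => y _; rewrite probe_upd ffunE eqxx.
Qed.
End GoodEvent.

(** * Regret on the good event *)

Section Deviation.
Variables (R : realType) (S A : finType) (n K J : nat).
Variables (P : S -> A -> S -> R) (r : S -> A -> R) (s0 : S) (pistar : S -> A).
Variables (L : R).
Hypothesis hP : is_kernel P.
Hypothesis hr : forall s a, 0 <= r s a <= 1.
Hypothesis n0 : (0 < n)%N.
Hypothesis L1 : 1 <= L.

Local Notation N := (n%:R : R).
Local Notation g := (1 - n%:R^-1 : R).

Lemma horizon_discount : 0 <= g < 1 /\ forall x : R, x / (1 - g) = n%:R * x.
Proof.
have NR : 1 <= N by rewrite ler1n.
have NR0 : 0 < N by lra.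
split; last by move=> x; rewrite opprB addrC subrK invrK mulrC.
rewrite subr_ge0 invf_le1 // NR /=.
by have : 0 < N^-1 by [rewrite invr_gt0]; lra.
Qed.

Let N0 : 0 < N. Proof. by rewrite ltr0n. Qed.
Let L0 : 0 < L. Proof. exact: lt_le_trans ltr01 L1. Qed.
Let hg : 0 <= g < 1. Proof. by case: horizon_discount. Qed.
Let gN x : x / (1 - g) = N * x. Proof. by case: horizon_discount. Qed.

Lemma bern_scaleE (f : S -> R) : bern_scale n L f * (N * padded_spn f * bern_scale n L f) = L.
Proof.
have t0 := padded_spn_gt0 f.
rewrite mulrCA mulrA -mulrA -expr2 sqr_sqrtr; first by field; rewrite !lt0r_neq0.
by rewrite divr_ge0 ?mulr_ge0 // ltW.
Qed.

Lemma bern_scale_padded_spn (f : S -> R) : N * padded_spn f * bern_scale n L f = Num.sqrt (N * L * padded_spn f).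
Proof.
have t0 := padded_spn_gt0 f; have l0 := bern_scale_gt0 n0 L0 f.
rewrite -[LHS]ger0_norm ?mulr_ge0 ?ltW // -sqrtr_sqr; congr Num.sqrt.
have -> : (N * padded_spn f * bern_scale n L f) ^+ 2 = N * padded_spn f * (bern_scale n L f * (N * padded_spn f * bern_scale n L f)).
  by ring.
by rewrite bern_scaleE; ring.
Qed.

(** Here [256 = 16^2] encodes [16 lam tau <= 1]. Since [L / (N lam) = lam tau], the bound
    [16 lam tau + 2 L / (N lam)] becomes [18 lam tau], times the horizon. *)
Lemma model_deviation (w : {ffun S * A -> {ffun 'I_n -> S}}) pi : let f := disc_value g P r pi in
  (forall s, ~~ bad_vec P s0 L (s, pi s) (w (s, pi s)) f) ->
  256 * (L * padded_spn f) <= N ->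
  forall s, `|disc_value g (emp R w) r pi s - f s| <= 18 * Num.sqrt (N * L * padded_spn f).
Proof.
move=> f hbad hreg s; have t0 := padded_spn_gt0 f; have l0 := bern_scale_gt0 n0 L0 f.
have hE : is_kernel (emp R w) by exact: emp_is_kernel.
have hc : 16 * bern_scale n L f * padded_spn f <= 1.
  have h16 : 0 <= 16 * bern_scale n L f * padded_spn f by rewrite !mulr_ge0 // ltW.
  rewrite -(@expr_le1 _ 2) // -(ler_pM2l N0) mulr1; apply: le_trans hreg.
  have -> : N * (16 * bern_scale n L f * padded_spn f) ^+ 2 =
    256 * (bern_scale n L f * (N * padded_spn f * bern_scale n L f)) * padded_spn f by ring.
  by rewrite bern_scaleE mulrA.
have -> : 18 * Num.sqrt (N * L * padded_spn f) =
    (16 * bern_scale n L f * padded_spn f + 2 * (L / (N * bern_scale n L f))) / (1 - g).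
  rewrite gN -bern_scale_padded_spn -{3}(bern_scaleE f); field; by rewrite !lt0r_neq0.
have hb s1 : (`|mean (emp R w s1 (pi s1)) (fun x => f x - fmin s0 f) -
      mean (P s1 (pi s1)) (fun x => f x - fmin s0 f)| <=
      2 * bern_scale n L f * var (P s1 (pi s1)) (fun x => f x - fmin s0 f) + L / (N * bern_scale n L f)) /\
   (`|mean (emp R w s1 (pi s1)) (fun x => (f x - fmin s0 f) ^+ 2) -
      mean (P s1 (pi s1)) (fun x => (f x - fmin s0 f) ^+ 2)| <=
      2 * (bern_scale n L f / padded_spn f) * var (P s1 (pi s1)) (fun x => (f x - fmin s0 f) ^+ 2)
      + L / (N * (bern_scale n L f / padded_spn f))).
  have := hbad s1; rewrite /bad_vec hc /= negb_or /tail -!leNgt => /andP[h1 h2].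
  by rewrite !emp_mean.
apply: (value_gap_model (m := fmin s0 f)) => //.
- by exists [arg min_(s < s0) f s]%O.
- move=> x; have /andP[-> h] := fmin_spn s0 f x; rewrite (le_trans h) // /padded_spn; lra.
- exact: ltW.
- by rewrite divr_ge0 ?mulr_ge0 // ltW.
- by move=> x; have [] := hb x.
- move=> x; have [_] := hb x.
  by rewrite (_ : padded_spn f * (L / (N * bern_scale n L f)) = L / (N * (bern_scale n L f / padded_spn f))) //;
    field; rewrite !lt0r_neq0.
Qed.

(** The candidate [f] may change with the state, and with it its scale; the potential argument wants
    a single scale, so [q] is built from the span of [V] and dominates all of them. *)
Lemma empirical_deviation (w : {ffun S * A -> {ffun 'I_n -> S}}) pi : let V := disc_value g (emp R w) r pi in
  (forall s, exists2 f, (forall x, `|V x - f x| <= 2 / N) &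
     ~~ bad_vec P s0 L (s, pi s) (w (s, pi s)) f) ->
  144 * (144 * (L * (spn V + 1))) <= N ->
  forall s, `|V s - disc_value g P r pi s| <= 160 * Num.sqrt (N * L * (spn V + 1)).
Proof.
move=> V hf hreg s.
have hE : is_kernel (emp R w) by exact: emp_is_kernel.
have sp0 := spn_ge0 V; set sg := spn V in hreg sp0 *.
have N1 : 1 <= N by rewrite ler1n.
pose q := Num.sqrt (L / (N * (sg + 1))).
have q0 : 0 < q by rewrite sqrtr_gt0 divr_gt0 // mulr_gt0 //; lra.
have sg1 : 0 < sg + 1 by lra.
have qE : N * (q ^+ 2 * (sg + 1)) = L.
  rewrite sqr_sqrtr; first by field; rewrite !lt0r_neq0.
  by rewrite divr_ge0 ?mulr_ge0 // ltW.
pose Q := q * (sg + 1); have Q0 : 0 < Q by rewrite mulr_gt0.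
have QE : N * Q ^+ 2 = L * (sg + 1) by rewrite -qE /Q; ring.
have sqE : Num.sqrt (N * L * (sg + 1)) = N * Q.
  rewrite -[RHS]ger0_norm ?mulr_ge0 ?ltW // -sqrtr_sqr; congr Num.sqrt.
  by rewrite -mulrA -QE; ring.
have Q144 : 144 * Q <= 1.
  have h144 : 0 <= 144 * Q by rewrite mulr_ge0 // ltW.
  rewrite -(@expr_le1 _ 2) // -(ler_pM2l N0) mulr1; apply: le_trans hreg.
  by rewrite -QE le_eqVlt; apply/orP; left; apply/eqP; ring.
have qQ : q <= Q by apply: ler_peMr; [exact: ltW | lra].
have NQ : N^-1 <= Q.
  have iN : 0 <= N^-1 by rewrite invr_ge0 ltW.
  have Q0' := ltW Q0; rewrite -ler_sqr ?nnegrE // -(ler_pM2l N0) QE.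
  have -> : N * N^-1 ^+ 2 = N^-1 by field; rewrite lt0r_neq0.
  apply: (@le_trans _ _ 1); first by rewrite invf_le1.
  by rewrite -[1]mulr1 ler_pM //; lra.
have -> : 160 * Num.sqrt (N * L * (sg + 1)) = (160 * Q) / (1 - g).
  by rewrite gN sqE; ring.
(* The [8 Q] collects [Q] from the squared approximation error, [4 Q] from twice the error [2 / N],
   and [3 Q] from [L / (N lam)]. *)
have key s1 : `|mean (emp R w s1 (pi s1)) (fun x => V x - fmin s0 V) -
    mean (P s1 (pi s1)) (fun x => V x - fmin s0 V)| <=
    4 * q * var (P s1 (pi s1)) (fun x => V x - fmin s0 V) + 8 * Q.
  have [f hVf hbad] := hf s1.
  have t0 := padded_spn_gt0 f; have l0 := bern_scale_gt0 n0 L0 f.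
  have e4 : 2 / N <= 2 by rewrite ler_pdivrMr // ler_peMr.
  have spf : spn f <= sg + 4.
    apply: spn_le => [|x y]; first by lra.
    have := hVf x; have := hVf y; rewrite !ler_norml => /andP[? ?] /andP[? ?].
    by have := spn_ge V x y; rewrite -/sg; lra.
  have spV : sg <= spn f + 4.
    apply: spn_le => [|x y]; first by have := spn_ge0 f; lra.
    have := hVf x; have := hVf y; rewrite !ler_norml => /andP[? ?] /andP[? ?].
    by have := spn_ge f x y; lra.
  have lq : bern_scale n L f <= q.
    rewrite /bern_scale /q ler_wsqrtr // ler_pM2l // lef_pV2 ?posrE ?mulr_gt0 //.
    by rewrite ler_pM2l // /padded_spn; lra.
  have lt3 : bern_scale n L f * padded_spn f <= 3 * Q.
    have lt0' : 0 <= bern_scale n L f * padded_spn f by rewrite mulr_ge0 // ltW.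
    have Q0' : 0 <= 3 * Q by rewrite mulr_ge0 // ltW.
    rewrite -ler_sqr ?nnegrE // -(ler_pM2l N0).
    have -> : N * (bern_scale n L f * padded_spn f) ^+ 2 = (bern_scale n L f * (N * padded_spn f * bern_scale n L f)) * padded_spn f by ring.
    have -> : N * (3 * Q) ^+ 2 = L * (9 * (sg + 1)) by rewrite exprMn mulrCA QE; ring.
    by rewrite bern_scaleE ler_pM2l // /padded_spn; lra.
  have hc : 16 * bern_scale n L f * padded_spn f <= 1 by rewrite -mulrA; lra.
  move: hbad; rewrite /bad_vec hc /= negb_or /tail -!leNgt => /andP[h1 _].
  have {}h1 : `|mean (emp R w s1 (pi s1)) (fun x => f x - fmin s0 f) -
      mean (P s1 (pi s1)) (fun x => f x - fmin s0 f)| <=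
      2 * bern_scale n L f * var (P s1 (pi s1)) (fun x => f x - fmin s0 f) + L / (N * bern_scale n L f).
    by rewrite emp_mean.
  have hpE := kernel_pmf s1 (pi s1) hE; have hpP := kernel_pmf s1 (pi s1) hP.
  have h2 := mean_gap_approx (fmin s0 V) hpP hpE (ltW l0) hVf h1.
  apply: (le_trans h2); apply: lerD.
    by rewrite ler_wpM2r ?var_ge0 // ler_wpM2l.
  have h3 : 4 * bern_scale n L f * (2 / N) ^+ 2 <= N^-1.
    have l1 : 16 * bern_scale n L f <= 1 by lra.
    have -> : 4 * bern_scale n L f * (2 / N) ^+ 2 = (16 * bern_scale n L f) * (N^-1 * N^-1) by field; rewrite lt0r_neq0.
    apply: le_trans (ler_wpM2r _ l1) _; first by rewrite mulr_ge0 ?invr_ge0 // ltW.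
    by rewrite mul1r; apply: ler_piMr; [rewrite invr_ge0 ltW | rewrite invf_le1].
  have -> : L / (N * bern_scale n L f) = bern_scale n L f * padded_spn f.
    by rewrite -{1}(bern_scaleE f); field; rewrite !lt0r_neq0.
  have : 2 * (2 / N) = 4 * N^-1 by ring.
  lra.
(* [16 q (sg + 9)] is at most [144 Q], which [hreg] keeps below 1; adding [2 * 8 Q] gives 160. *)
apply: le_trans (_ : (16 * q * (sg + 9) + 2 * (8 * Q)) / (1 - g) <= _); last first.
  rewrite !gN ler_pM2l //.
  have -> : 16 * q * (sg + 9) = 16 * Q + 128 * q by rewrite /Q; ring.
  lra.
apply: (value_gap_empirical (m := fmin s0 V)) => //.
- by exists [arg min_(s < s0) V s]%O.
- move=> x; have /andP[-> h] := fmin_spn s0 V x; rewrite (le_trans h) // -/sg; lra.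
- exact: ltW.
- by rewrite mulr_ge0 // ltW.
- have -> : 16 * q * (sg + 9) = 16 * Q + 128 * q by rewrite /Q; ring.
  lra.
Qed.
End Deviation.

Section Regret.
Variables (R : realType) (S A : finType) (n K : nat).
Variables (P : S -> A -> S -> R) (r : S -> A -> R) (s0 : S) (pistar : S -> A).
Variables (L : R).
Hypothesis hP : is_kernel P.
Hypothesis hr : forall s a, 0 <= r s a <= 1.
Hypothesis n0 : (0 < n)%N.
Hypothesis K0 : (0 < K)%N.
Hypothesis L1 : 1 <= L.

Local Notation N := (n%:R : R).
Local Notation g := (1 - n%:R^-1 : R).
Local Notation xi := ((2 * n%:R ^+ 2)^-1 : R).
(** [om] exceeds the loss [2 n xi / K] from rounding the reward to a corner. It equals [2 / (n K)],
    which also exceeds the loss from rounding the payoff to the grid; the [.+1] in [J] makes this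
    strict. *)
Local Notation om := (4 * n%:R * xi / K%:R : R).
Local Notation J := (2 * n ^ 3 * K).+1.

Let N0 : 0 < N. Proof. by rewrite ltr0n. Qed.
Let N1 : 1 <= N. Proof. by rewrite ler1n. Qed.
Let KR : 1 <= K%:R :> R. Proof. by rewrite ler1n. Qed.
Let hg : 0 <= g < 1. Proof. exact: (horizon_discount R n0).1. Qed.
Let gN x : x / (1 - g) = N * x. Proof. exact: (horizon_discount R n0).2. Qed.

Variables (w : {ffun S * A -> {ffun 'I_n -> S}}) (c : {ffun S * A -> 'I_K}).
Variables (rt : S -> A -> R) (pihat : S -> A).
Hypothesis hgood : good J P r s0 pistar g xi om L w c.
Hypothesis hcell : forall s a,
  xi * (c (s, a))%:R / K%:R < rt s a - r s a <= xi * (c (s, a)).+1%:R / K%:R.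
Hypothesis hopt : blackwell_optimal (anchor n%:R^-1 s0 (emp R w)) rt pihat.

Let hE : is_kernel (emp R w). Proof. exact: emp_is_kernel. Qed.
Let hW : subkernel (emp R w). Proof. exact: is_kernelW hE. Qed.

Lemma pihat_opt : is_opt g (emp R w) rt (disc_value g (emp R w) rt pihat).
Proof.
apply: (blackwell_anchor_opt _ hE hopt).
by rewrite invr_gt0 N0 /= invf_le1.
Qed.

Lemma corner_close s a : `|rt s a - corner r xi c s a| <= xi / K%:R.
Proof.
have /andP[h1 h2] := hcell s a.
have xK : 0 <= xi / K%:R.
  by rewrite divr_ge0 ?invr_ge0 ?mulr_ge0 ?exprn_ge0 ?ler0n.
have e : xi * (c (s, a)).+1%:R / K%:R = xi * (c (s, a))%:R / K%:R + xi / K%:R.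
  by rewrite -natr1; ring.
rewrite /corner ler_norml; apply/andP; split; lra.
Qed.

Let xi0 : 0 < xi. Proof. by rewrite invr_gt0 mulr_gt0 // exprn_gt0. Qed.
Let Nxi : N * xi = (2 * N)^-1.
Proof. by field; rewrite lt0r_neq0. Qed.
Let xile : xi <= 2^-1.
Proof. by rewrite lef_pV2 ?posrE ?mulr_gt0 ?exprn_gt0 // ler_peMr // exprn_ege1. Qed.

Let frac s a : 0 <= ((c (s, a))%:R / K%:R : R) <= 1.
Proof. by rewrite divr_ge0 ?ler0n //= ler_pdivrMr ?ltr0n // mul1r ler_nat ltnW. Qed.

Lemma perturbation_bounds s a : 0 <= rt s a - r s a <= xi.
Proof.
have /andP[h1 h2] := hcell s a; have K0' : 0 < K%:R :> R by rewrite ltr0n.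
apply/andP; split.
  by apply: le_trans (ltW h1); rewrite divr_ge0 ?mulr_ge0 ?ler0n // ltW.
apply: (le_trans h2); rewrite -mulrA ler_piMr ?(ltW xi0) //.
by rewrite ler_pdivrMr // mul1r ler_nat.
Qed.

Lemma corner_bounds s a : 0 <= corner r xi c s a <= 2.
Proof.
have /andP[h1 h2] := hr s a; have /andP[h3 h4] := frac s a.
have := ler_wpM2l (ltW xi0) h4; have := mulr_ge0 (ltW xi0) h3.
by rewrite /corner mulrA mulr1 => h5 h6; apply/andP; split; have := xile; lra.
Qed.

Let Vc := ovalue r g xi w c.
Let Vc_opt : is_opt g (emp R w) (corner r xi c) Vc.
Proof. exact: (optvalP _ (pistar s0) hW hg). Qed.

Let Jr : J%:R = 2 * N ^+ 3 * K%:R + 1 :> R.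
Proof. by rewrite -addn1 natrD natrM natrM natrX. Qed.

Lemma grid_near (q : R) : 0 <= q <= 2 * N ->
  exists j : 'I_J.+1, `|grid R n j - q| <= 2 * N / J%:R.
Proof.
move=> /andP[q0 q2]; have J0 : 0 < J%:R :> R by rewrite ltr0n.
pose x := q * J%:R / (2 * N).
have NN : 0 < 2 * N by rewrite mulr_gt0.
have x0 : 0 <= x by rewrite divr_ge0 ?mulr_ge0 // ltW.
have xJ : x <= J%:R by rewrite ler_pdivrMr // mulrC ler_pM2l.
have /andP[t1 t2] := truncn_itv x0.
have tJ : (Num.truncn x < J.+1)%N.
  by rewrite ltnS -(ler_nat R) (le_trans t1).
exists (Ordinal tJ); rewrite /grid /=.
have qx : q = x * (2 * N / J%:R) by rewrite /x; field; rewrite !lt0r_neq0.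
have -> : 2 * N * (Num.truncn x)%:R / J%:R - q = - ((x - (Num.truncn x)%:R) * (2 * N / J%:R)).
  by rewrite [in LHS]qx; ring.
have w0 : 0 <= 2 * N / J%:R by rewrite divr_ge0 ?ltW.
rewrite normrN ger0_norm; last by rewrite mulr_ge0 // subr_ge0.
by rewrite ler_piMl // lerBlDr addrC natr1 ltW.
Qed.

Lemma Vc_qval_bounds p : 0 <= qval g (emp R w) (corner r xi c) Vc p.1 p.2 <= 2 * N.
Proof.
have hb := is_opt_bounds hW hg (ler0n _ 2) corner_bounds Vc_opt.
have /andP[_ h2] := hb p.1; rewrite gN mulrC in h2.
apply/andP; split; last by apply: le_trans h2; exact: (Vc_opt p.1).1.
rewrite /qval addr_ge0 //; first by have /andP[] := corner_bounds p.1 p.2.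
rewrite mulr_ge0 //; first by case/andP: hg.
by apply: sumr_ge0 => y _; rewrite mulr_ge0 ?(hE _ _).1 //; have /andP[] := hb y.
Qed.

Let no_tie s a a' : near_opt r g xi om w c s a -> near_opt r g xi om w c s a' -> a = a'.
Proof.
move=> h1 h2; have /forallP/(_ (s, a))/andP[h _] := hgood.
apply/eqP; apply: contraNT h => aa; rewrite /gap_bad /= h1 /=.
by apply/existsP; exists a'; rewrite eq_sym aa.
Qed.

Lemma pihat_near s : near_opt r g xi om w c s (pihat s).
Proof.
have e := disc_valueE rt pihat s hW hg.
have := perturbed_near (a := pihat s) hE hg Vc_opt pihat_opt corner_close e.
rewrite gN => h; rewrite /near_opt -/Vc; apply: lt_le_trans h.
rewrite ltrD2l ltrN2; have K0' : 0 < K%:R :> R by rewrite ltr0n.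
have : 0 < N * (xi / K%:R) by rewrite mulr_gt0 // divr_gt0.
have -> : om = 4 * (N * (xi / K%:R)) by ring.
lra.
Qed.

(** The greedy policy of the grid model and [pihat] are both near-optimal for the corner reward, so
    they agree once near ties are excluded. Equality is needed: near-optimality in the empirical
    model does not make true values close. *)
Lemma probe_close p : exists j : 'I_J.+1,
  (forall s, `|loo_value r g xi p w c j s - Vc s| <= N^-1) /\
  loo_policy r pistar g xi p w c j = pihat.
Proof.
have [j hj] := grid_near (Vc_qval_bounds p); exists j.
have K0' : 0 < K%:R :> R by rewrite ltr0n.
have N3 : 0 < N ^+ 3 by rewrite exprn_gt0.
have J0 : 0 < J%:R :> R by rewrite ltr0n.
have NJ : N * (2 * N / J%:R) <= (N * K%:R)^-1.
  rewrite mulrA ler_pdivrMr // Jr -ler_pdivrMl ?invr_gt0 ?mulr_gt0 // invrK.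
  have -> : N * K%:R * (N * (2 * N)) = 2 * N ^+ 3 * K%:R by ring.
  by rewrite lerDl.
split.
  move=> s; have := loo_optval_close hE hg Vc_opt hj s; rewrite gN => h.
  apply: (le_trans h); apply: (le_trans NJ).
  by rewrite lef_pV2 ?posrE ?mulr_gt0 // ler_peMr // ltW.
apply/funext => s; apply: (@no_tie s) (pihat_near s).
have := loo_greedy_near pistar s hE hg Vc_opt hj; rewrite gN => h.
rewrite /near_opt -/Vc; apply: lt_le_trans h; rewrite ltrD2l ltrN2.
have -> : om = 2 * (N * K%:R)^-1 by field; rewrite !lt0r_neq0.
rewrite ltr_pM2l //; apply: lt_le_trans (_ : N * (2 * N / (2 * N ^+ 3 * K%:R)) <= _).
  rewrite ltr_pM2l // ltr_pM2l ?mulr_gt0 // ltf_pV2 ?posrE ?mulr_gt0 // Jr.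
  by rewrite ltrDl.
by rewrite le_eqVlt; apply/orP; left; apply/eqP; field; rewrite !lt0r_neq0.
Qed.

Let good_vec p (i : option ('I_J.+1 * bool)) : ~~ bad_vec P s0 L p (w p) (probe P r pistar g xi p w c i).
Proof. by have /forallP/(_ p)/andP[_ /forallP] := hgood; apply. Qed.

Lemma pistar_deviation : let f := disc_value g P r pistar in
  256 * (L * padded_spn f) <= N ->
  forall s, `|disc_value g (emp R w) r pistar s - f s| <= 18 * Num.sqrt (N * L * padded_spn f).
Proof.
move=> f hreg; apply: (model_deviation (s0 := s0)) => // s.
exact: (good_vec (s, pistar s) None).
Qed.

Lemma pihat_deviation_model : let f := disc_value g P r pihat in
  256 * (L * padded_spn f) <= N ->
  forall s, `|disc_value g (emp R w) r pihat s - f s| <= 18 * Num.sqrt (N * L * padded_spn f).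
Proof.
move=> f hreg; apply: (model_deviation (s0 := s0)) => // s.
have [j [_ e]] := probe_close (s, pihat s).
by have := good_vec (s, pihat s) (Some (j, false)); rewrite /probe e.
Qed.

Lemma reward_gap s :
  `|disc_value g (emp R w) r pihat s - disc_value g (emp R w) rt pihat s| <= (2 * N)^-1.
Proof.
rewrite -Nxi -gN; apply: disc_value_lip => // x a.
by rewrite distrC; have /andP[h1 h2] := perturbation_bounds x a; rewrite ger0_norm.
Qed.

Lemma pihat_deviation_empirical : let V := disc_value g (emp R w) r pihat in
  144 * (144 * (L * (spn V + 1))) <= N ->
  forall s, `|V s - disc_value g P r pihat s| <= 160 * Num.sqrt (N * L * (spn V + 1)).
Proof.
move=> V hreg; apply: (empirical_deviation (s0 := s0)) => // s.
have [j [hj _]] := probe_close (s, pihat s).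
exists (loo_value r g xi (s, pihat s) w c j); last exact: (good_vec (s, pihat s) (Some (j, true))).
move=> x; have h1 := hj x; have h2 := reward_gap x.
have xK : 0 <= xi / K%:R by rewrite divr_ge0 ?ler0n // ltW.
have h3 := is_opt_lip hW hg xK pihat_opt Vc_opt corner_close x.
have h4 : xi / K%:R / (1 - g) <= (2 * N)^-1.
  by rewrite gN -Nxi ler_pM2l // ler_pdivrMr ?ltr0n // ler_peMr // ltW.
have {}h3 := le_trans h3 h4.
(* The three errors: removing the perturbation, rounding it to the corner, and rounding the payoff
   to the grid. *)
have e2 : 2 / N = (2 * N)^-1 + (2 * N)^-1 + N^-1 by field; rewrite lt0r_neq0.
rewrite e2; move: h1 h2 h3; rewrite -/V !ler_norml => /andP[? ?] /andP[? ?] /andP[? ?].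
apply/andP; split; lra.
Qed.

Lemma regret_bound : weakly_communicating P -> blackwell_optimal P r pistar ->
  let H := spn (bias P r pistar) +
    Num.min (spn (bias (anchor n%:R^-1 s0 (emp R w)) r pihat))
            (spn (bias (anchor n%:R^-1 s0 P) r pihat)) + 1 in
  144 * (144 * (L * H)) <= N ->
  forall s, gain P r pistar s - gain P r pihat s <= 216 * Num.sqrt (L * H / N).
Proof.
move=> hwc hb H hreg s.
have heta : 0 < N^-1 <= 1 by rewrite invr_gt0 N0 /= invf_le1.
have eh := spn_bias_anchor s0 r pihat heta hE.
have eP := spn_bias_anchor s0 r pihat heta hP.
rewrite /H eh eP in hreg * => {eh eP H}.
set sg := spn (bias P r pistar) in hreg *.
set Vh := disc_value g (emp R w) r pihat in hreg *.
set V := disc_value g P r pihat in hreg *.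
set V1 := disc_value g P r pistar.
set mu := Num.min _ _ in hreg *; set h := sg + mu + 1 in hreg *.
have sg0 : 0 <= sg by exact: spn_ge0.
have mu0 : 0 <= mu by rewrite le_min !spn_ge0.
have L0 : 0 < L by exact: lt_le_trans ltr01 L1.
have h1 : 1 <= h by rewrite /h; lra.
pose B := Num.sqrt (N * L * h).
have Bmono k x : 0 <= k -> x <= k ^+ 2 * h -> Num.sqrt (N * L * x) <= k * B.
  move=> k0 xk; rewrite -[k]ger0_norm // -sqrtr_sqr -sqrtrM ?sqr_ge0 //.
  apply: ler_wsqrtr; have -> : k ^+ 2 * (N * L * h) = N * L * (k ^+ 2 * h) by ring.
  by rewrite ler_wpM2l // mulr_ge0 // ltW.
have gstar := disc_value_gain r pistar hP hg.
have gconst := blackwell_gain_constant hP hwc (fun s a => (andP (hr s a)).1) hb.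
have sV1 : spn V1 <= 2 * sg.
  apply: spn_le => [|x y]; first by rewrite mulr_ge0.
  have := gstar x; have := gstar y; rewrite (gconst x y) -/sg -/V1 !ler_norml.
  by move=> /andP[? ?] /andP[? ?]; lra.
have reg k x : 0 <= x -> x <= k * h -> 0 <= k <= 9 -> 256 * (L * x) <= N.
  move=> x0 xk /andP[k0 k9]; apply: le_trans hreg.
  have : L * x <= 9 * (L * h).
    apply: (@le_trans _ _ (L * (k * h))); first by rewrite ler_pM2l.
    rewrite mulrCA ler_wpM2r // mulr_ge0 //; lra.
  have : 0 <= L * h by rewrite mulr_ge0 //; lra.
  lra.
have d1 x : V1 x - disc_value g (emp R w) r pistar x <= 54 * B.
  have t5 : padded_spn V1 <= 5 * h by rewrite /padded_spn /h; lra.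
  have t0 := ltW (padded_spn_gt0 V1).
  have := pistar_deviation (reg 5 _ t0 t5 (ltac:(by apply/andP; split; lra))) x.
  have : Num.sqrt (N * L * padded_spn V1) <= 3 * B by apply: Bmono => //; lra.
  by rewrite -/V1 ler_norml => b /andP[? ?]; lra.
have d2 x : disc_value g (emp R w) r pistar x <= Vh x + (2 * N)^-1.
  have e1 : disc_value g (emp R w) r pistar x <= disc_value g (emp R w) rt pistar x.
    by apply: disc_value_le => // y a; have /andP[] := perturbation_bounds y a; lra.
  have e2 := is_opt_ge pistar hW hg pihat_opt x.
  have := reward_gap x; rewrite -/Vh ler_norml => /andP[? ?]; lra.
have d3 x : Vh x - V x <= 160 * B.
  rewrite /h in h1 *; case: (leP (spn Vh) (spn V)) => hm.
    have muE : mu = spn Vh by rewrite /mu min_l.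
    have hle : spn Vh + 1 <= h by rewrite /h muE; lra.
    have hreg2 : 144 * (144 * (L * (spn Vh + 1))) <= N.
      apply: le_trans hreg; have : L * (spn Vh + 1) <= L * h by rewrite ler_pM2l.
      have : 0 <= L * h by rewrite mulr_ge0 //; [lra | rewrite /h; lra].
      lra.
    have := pihat_deviation_empirical hreg2 x.
    have : Num.sqrt (N * L * (spn Vh + 1)) <= 1 * B.
      by apply: Bmono => //; rewrite expr1n mul1r.
    by rewrite -/Vh -/V ler_norml => b /andP[? ?]; lra.
  have muE : mu = spn V by rewrite /mu min_r // ltW.
  have t5 : padded_spn V <= 5 * h by rewrite /padded_spn /h muE; lra.
  have t0 := ltW (padded_spn_gt0 V).
  have := pihat_deviation_model (reg 5 _ t0 t5 (ltac:(by apply/andP; split; lra))) x.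
  have : Num.sqrt (N * L * padded_spn V) <= 3 * B.
    by apply: Bmono => //; rewrite /h in t5 *; lra.
  have B0 : 0 <= B by exact: sqrtr_ge0.
  by rewrite -/Vh -/V ler_norml => b /andP[? ?]; lra.
have Lh1 : 1 <= L * h by rewrite -[1]mulr1 ler_pM.
have B1 : 1 <= B.
  by rewrite -sqrtr1; apply: ler_wsqrtr; rewrite -mulrA; apply: mulr_ege1.
have hN : h <= N.
  have : h <= L * h by rewrite ler_peMl //; lra.
  by lra.
have sgB : sg <= B.
  apply: (@le_trans _ _ h); first by rewrite /h; lra.
  rewrite -[h]ger0_norm; last by lra.
  rewrite -sqrtr_sqr; apply: ler_wsqrtr; rewrite expr2 ler_wpM2r //; first by lra.
  by apply: (le_trans hN); rewrite ler_peMr // ltW.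
have [s1 _ hs1] := @Order.TotalTheory.arg_minP _ _ _ s xpredT V isT.
have ghat := @gain_ge_disc_value _ _ _ g P r pihat (V s1) hP hg (fun x => hs1 x isT) s.
have gs1 := gstar s1; rewrite gN -/V1 ler_norml -/sg in gs1.
have /andP[gs2 _] := gs1.
have e1 : gain P r pistar s = gain P r pistar s1 by exact: gconst.
have nn : (2 * N)^-1 <= 1 by rewrite invf_le1 ?mulr_gt0 //; have := N1; lra.
(* [216 = 54 + 160 + 1 + 1]: the model error of [pistar] (18 times 3, its padded span being at most
   [9 h]), that of [pihat], the reward perturbation, and the span of the optimal bias. All are
   compared at the minimiser [s1] of the true value of [pihat]. *)
have tot : N * (gain P r pistar s - gain P r pihat s) <= 216 * B.
  have : N * ((1 - g) * V s1) <= N * gain P r pihat s by rewrite ler_pM2l.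
  have -> : N * ((1 - g) * V s1) = V s1 by field; rewrite lt0r_neq0.
  rewrite mulrBr e1; have := d1 s1; have := d2 s1; have := d3 s1. lra.
have -> : Num.sqrt (L * h / N) = B / N.
  have LhN : 0 <= L * h / N by rewrite divr_ge0 ?ltW //; lra.
  have -> : B = Num.sqrt (L * h / N) * N; last by rewrite mulfK // lt0r_neq0.
  have -> : B = Num.sqrt (L * h / N * N ^+ 2).
    by rewrite /B; congr Num.sqrt; field; rewrite lt0r_neq0.
  by rewrite sqrtrM // sqrtr_sqr ger0_norm // ltW.
by rewrite mulrA ler_pdivlMr // mulrC.
Qed.
End Regret.

(** * Arithmetic of the failure probability, and assembly *)

Section Numerics.
Variable R : realType.

Lemma ln_ge_half (x : R) : 2 <= x -> 2^-1 <= ln x.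
Proof.
move=> x2; rewrite -[leLHS]expRK ler_ln ?posrE ?expR_gt0 //; last by lra.
by have := @expR_le_quad R 2^-1 (lexx _); lra.
Qed.

(** Each half of [delta] pays for one kind of failure. Near ties: [m + 1 <= 9 n^2] against
    [K >= 18 x^2]. Bernstein: at most [81 x^5] candidates per pair and at most [delta x] pairs,
    against [exp (- L) = x^(-20)]; the exponent 20 leaves room for the constant 648 because
    [x >= 2]. *)
Lemma failure_budget (s a n K J m : nat) (delta : R) :
  (0 < s)%N -> (0 < a)%N -> (0 < n)%N -> 0 < delta < 1 ->
  let x := s%:R * a%:R * n%:R / delta in
  2 <= x -> 18 * x ^+ 2 <= K%:R -> K%:R <= 18 * x ^+ 2 + 1 ->
  m = (4 * n * n.+1)%N -> J = (2 * n ^ 3 * K).+1 ->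
  (s * a)%:R * (m.+1%:R / K%:R + (J.+1 * 2).+1%:R * (4 * expR (- (20 * ln x)))) <= delta.
Proof.
move=> hs ha hn /andP[d0 d1] x x2 K1 K2 -> ->.
have x0 : 0 < x by lra.
rewrite natrM; set b : R := s%:R * a%:R.
have b1 : 1 <= b by apply: mulr_ege1; rewrite ler1n.
have N1 : 1 <= n%:R :> R by rewrite ler1n.
set N : R := n%:R in N1.
have xd : delta * x = b * N by rewrite /x -/b -/N; field; rewrite lt0r_neq0.
have Nx : N <= x.
  rewrite -(ler_pM2l d0) xd; apply: (@le_trans _ _ (1 * N)); first by rewrite ler_wpM2r; lra.
  by rewrite ler_wpM2r //; lra.
have KR : 0 < K%:R :> R by apply: lt_le_trans K1; rewrite mulr_gt0 ?exprn_gt0.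
set k : R := K%:R in K1 K2 KR.
rewrite mulrDr; set e := expR _.
have e20 : x ^+ 20 * e = 1.
  rewrite /e expRN expRM_natl lnK ?posrE // divff // expf_neq0 // lt0r_neq0 //.
have e0 : 0 < e by exact: expR_gt0.
have -> : delta = delta / 2 + delta / 2 by field.
apply: lerD.
  rewrite mulrA ler_pdivrMr //.
  have h1 : (4 * n * n.+1).+1%:R <= 9 * N ^+ 2 :> R.
    have -> : (4 * n * n.+1).+1%:R = 4 * N ^+ 2 + 4 * N + 1 :> R.
      by rewrite -addn1 natrD natrM natrM -[n.+1]addn1 natrD -/N; ring.
    have : N <= N ^+ 2 by rewrite expr2 ler_peMr //; lra.
    have : 1 <= N ^+ 2 by rewrite expr2 mulr_ege1.
    lra.
  have h2 : delta * (18 * x ^+ 2) <= delta * k by rewrite ler_pM2l.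
  have h3 : b * N ^+ 2 <= delta * x ^+ 2.
    have -> : delta * x ^+ 2 = b * N * x by rewrite -xd; ring.
    by rewrite expr2 mulrA ler_wpM2l // mulr_ge0; lra.
  have h4 : b * (4 * n * n.+1).+1%:R <= b * (9 * N ^+ 2) by rewrite ler_wpM2l; lra.
  lra.
have -> : ((2 * n ^ 3 * K).+2 * 2).+1%:R = 4 * (N ^+ 3 * k) + 5 :> R.
  by rewrite -natr1 natrM -addn2 natrD natrM natrM natrX -/N -/k; ring.
have N3 : N ^+ 3 <= x ^+ 3 by rewrite lerXn2r ?nnegrE; lra.
have x3 : 0 < x ^+ 3 by rewrite exprn_gt0.
have h1 : N ^+ 3 * k <= x ^+ 3 * (18 * x ^+ 2 + 1).
  have N30 : 0 <= N ^+ 3 by apply: exprn_ge0; lra.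
  by have k0 := ltW KR; apply: ler_pM.
have x24 : 4 <= x ^+ 2 by rewrite expr2; have : 2 * 2 <= x * x by [rewrite ler_pM; lra]; lra.
have x35 : 4 * x ^+ 3 <= x ^+ 5.
  by have -> : x ^+ 5 = x ^+ 2 * x ^+ 3 by [ring]; rewrite ler_pM2r.
have x38 : 8 <= x ^+ 3.
  have -> : x ^+ 3 = x ^+ 2 * x by ring.
  by have : 4 * 2 <= x ^+ 2 * x by [rewrite ler_pM //; lra]; lra.
have h2 : 4 * (N ^+ 3 * k) + 5 <= 81 * x ^+ 5.
  have : x ^+ 3 * (18 * x ^+ 2 + 1) = 18 * x ^+ 5 + x ^+ 3 by ring.
  lra.
have h3 : b <= delta * x by rewrite xd ler_peMr //; lra.
have x10 : 648 <= x ^+ 10.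
  apply: (@le_trans _ _ (2 ^+ 10)); first by rewrite -natrX ler_nat.
  by rewrite lerXn2r ?nnegrE; lra.
have x14 : 648 * x ^+ 6 <= x ^+ 20.
  have -> : x ^+ 20 = x ^+ 10 * (x ^+ 4 * x ^+ 6) by ring.
  have x4 : 1 <= x ^+ 4 by rewrite exprn_ege1; lra.
  have x6 : 0 < x ^+ 6 by rewrite exprn_gt0.
  have x40 : x ^+ 6 <= x ^+ 4 * x ^+ 6 := ler_peMl (ltW x6) x4.
  exact: (ler_pM (ler0n R 648) (ltW x6) x10 x40).
have h5 : b * ((4 * (N ^+ 3 * k) + 5) * (4 * e)) <= delta * x * (81 * x ^+ 5 * (4 * e)).
  apply: ler_pM => //; first by lra.
    by rewrite mulr_ge0 ?mulr_ge0 ?addr_ge0 ?mulr_ge0 ?exprn_ge0 //; lra.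
  by rewrite ler_pM2r // mulr_gt0.
apply: (le_trans h5).
have -> : delta * x * (81 * x ^+ 5 * (4 * e)) = delta / 2 * (648 * x ^+ 6 * e) by field.
have last1 : 648 * x ^+ 6 * e <= 1 by rewrite -[leRHS]e20 ler_pM2r.
by apply: ler_piMr => //; lra.
Qed.
End Numerics.

Theorem mainTheorem7 (R : realType) :
  exists C : R, 0 < C /\
  forall (S A : finType) (P : S -> A -> S -> R) (r : S -> A -> R) (s0 : S) (n : nat)
    (pistar : S -> A),
    is_kernel P ->
    (forall s a, 0 <= r s a <= 1) ->
    weakly_communicating P ->
    (0 < n)%N ->
    blackwell_optimal P r pistar ->
    let eta : R := n%:R^-1 in
    let xi : R := (2 * n%:R ^+ 2)^-1 in
    forall (d : measure_display) (T : measurableType d) (Pr : probability T R)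
      (X : T -> S -> A -> 'I_n -> S) (Delta : T -> S -> A -> R)
      (pihat : T -> S -> A),
    data_law Pr P xi X Delta ->
    (forall t, blackwell_optimal (anchor eta s0 (@emp_kernel R _ _ n (X t))) (fun s a => r s a + Delta t s a) (pihat t)) ->
    forall delta : R, 0 < delta < 1 ->
    exists E : set T, measurable E /\ ((1 - delta)%:E <= Pr E)%E /\
      forall t, E t -> forall s : S,
        gain P r pistar s - gain P r (pihat t) s <=
        Num.sqrt (C * ln (#|S|%:R * #|A|%:R * n%:R / delta) ^+ 3 / n%:R *
          (spn (bias P r pistar)
           + Num.min (spn (bias (anchor eta s0 (@emp_kernel R _ _ n (X t))) r (pihat t)))
                     (spn (bias (anchor eta s0 P) r (pihat t)))
           + 1)).
Proof.
(* [C] has to exceed [216^2 * 80], where 80 is 20 from [L = 20 l] times 4 from [l <= 4 l^3]. *)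
have [C C0 hC] : exists2 C : R, 0 < C & 2000 * 2000 <= C.
  exists (2000 * 2000); last exact: lexx.
  exact: (mulr_gt0 (ltr0Sn _ _) (ltr0Sn _ _)).
exists C; split; first exact: C0.
move=> S A P r s0 n pistar hP hr hwc n0 hb eta xi d T Pr X Delta pihat hlaw hopt delta hd.
have S0 : (0 < #|S|)%N by apply/card_gt0P; exists s0.
have A0 : (0 < #|A|)%N by apply/card_gt0P; exists (pistar s0).
have N0 : 0 < n%:R :> R by rewrite ltr0n.
have /andP[d0 d1] := hd.
(* If SAn is 1 the logarithm may be close to 0, but there is then a single policy and no regret.
   Otherwise [x >= 2]. *)
have [D1|D2] := leqP (#|S| * #|A| * n) 1.
  exists setT; split => //; split.
    by rewrite probability_setT lee_fin; lra.
  move=> t _ s; have A1 : (#|A| <= 1)%N.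
    apply: leq_trans D1; rewrite mulnAC leq_pmull // muln_gt0 S0 //.
  have -> : pihat t = pistar.
    by apply/funext => x; move/card_le1_eqP: A1; apply.
  by rewrite subrr sqrtr_ge0.
set x := #|S|%:R * #|A|%:R * n%:R / delta.
have x2 : 2 <= x.
  rewrite /x ler_pdivlMr // -!natrM; apply: (@le_trans _ _ 2%:R); first by lra.
  by rewrite ler_nat.
set l := ln x; have l2 : 2^-1 <= l by exact: ln_ge_half.
pose L := 20 * l; have L1 : 1 <= L by rewrite /L; lra.
(* The argument yields only the first power of the logarithm; [l >= 1/2] turns it into the cube. *)
have l3 : l / 4 <= l ^+ 3.
  have -> : l ^+ 3 = l * (l * l) by ring.
  rewrite ler_pM2l; last by lra.
  by have : 2^-1 * 2^-1 <= l * l by [rewrite ler_pM]; lra.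
pose K := (Num.truncn (18 * x ^+ 2)).+1.
have x20 : 0 <= 18 * x ^+ 2 by rewrite mulr_ge0 ?sqr_ge0.
have /andP[K2 K1] := truncn_itv x20; rewrite -/K in K1.
have K3 : K%:R <= 18 * x ^+ 2 + 1 by rewrite /K -natr1; exact: lerD K2 (lexx _).
have K0 : (0 < K)%N by [].
pose g : R := 1 - n%:R^-1; pose om : R := 4 * n%:R * xi / K%:R.
have [hg gN] := horizon_discount R n0.
have xi0 : 0 < xi by rewrite invr_gt0 mulr_gt0 // exprn_gt0.
have KR : 0 < K%:R :> R by rewrite ltr0n.
have om0 : 0 <= om by rewrite divr_ge0 ?mulr_ge0 ?ler0n // ltW.
(* With horizon [n], [K (om + n om)] is exactly [4 n (n + 1) xi], whence the window [m]. *)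
have hm : K%:R * (om + om / (1 - g)) <= xi * (4 * n * n.+1)%:R.
  rewrite gN natrM natrM -natr1 /om le_eqVlt; apply/orP; left; apply/eqP.
  by field; rewrite lt0r_neq0.
pose J := (2 * n ^ 3 * K).+1.
have L0 : 0 < L by lra.
have hgood := good_prob J r s0 pistar hP hg n0 K0 L0 xi0 om0 hm.
have hbud := failure_budget S0 A0 n0 hd x2 (ltW K1)
  K3 erefl (erefl J).
have [E [mE [pE hE]]] := cells_event hlaw xi0 K0 hP (le_trans hgood hbud).
exists E; split => //; split => // t /hE [w [c [hgd [hs hc]]]] s.
have eX : @emp_kernel R _ _ n (X t) = emp R w.
  by rewrite /emp; congr (emp_kernel R _); apply/funext => s1; apply/funext => a;
     apply/funext => k; exact: hs.
have ht := hopt t; rewrite eX in ht *.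
have hcell s1 a1 : xi * (c (s1, a1))%:R / K%:R < (r s1 a1 + Delta t s1 a1) - r s1 a1
    <= xi * (c (s1, a1)).+1%:R / K%:R by rewrite addrC addKr; exact: hc.
set H := _ + 1.
have H1 : 1 <= H.
  rewrite lerDr; apply: addr_ge0; first exact: spn_ge0.
  by rewrite le_min; apply/andP; split; exact: spn_ge0.
have l0 : 0 <= l by apply: le_trans l2; rewrite invr_ge0 ler0n.
have lH : 0 <= l ^+ 3 * H by exact: mulr_ge0 (exprn_ge0 3 l0) (le_trans ler01 H1).
(* For small [n] the right side is at least 1, which bounds any difference of gains; for large [n]
   the regime condition of [regret_bound] holds. *)
have [small|large] := leP n%:R (C * l ^+ 3 * H).
  apply: (@le_trans _ _ 1).
    by have /andP[_ h1] := gain01 pistar hP hr s; have /andP[h2 _] := gain01 (pihat t) hP hr s;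
       apply: le_trans h1; rewrite gerBl.
  rewrite -[leLHS]sqrtr1; apply: ler_wsqrtr.
  by rewrite mulrAC ler_pdivlMr // mul1r.
have ClH : 2000 * 2000 * (l ^+ 3 * H) <= C * (l ^+ 3 * H) by exact: ler_wpM2r lH _ _ hC.
have LH : L * H <= 80 * (l ^+ 3 * H).
  rewrite mulrA; apply: ler_wpM2r; first exact: le_trans ler01 H1.
  by rewrite /L; clear - l3; lra.
have hreg : 144 * (144 * (L * H)) <= n%:R.
  apply: ltW; apply: le_lt_trans large.
  by move: ClH LH lH; rewrite -(mulrA C); set z := l ^+ 3 * H; set y := L * H; lra.
have := regret_bound hP hr n0 K0 L1 hgd hcell ht hwc hb hreg s.
move=> /le_trans; apply.
rewrite -[216]ger0_norm // -sqrtr_sqr -sqrtrM ?sqr_ge0 //; apply: ler_wsqrtr.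
rewrite mulrA [leRHS]mulrAC ler_pM2r ?invr_gt0 // expr2.
by move: ClH LH lH; rewrite -(mulrA C); set z := l ^+ 3 * H; set y := L * H; lra.
Qed.
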